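(* Let $p\in(0,1)$ be a constant and let $k=k(n)$ satisfy $k=(1+o(1))\log_{1/p} n$. Let $H$ be the $k$-clique $K_k$. Then there exists a fully polynomial time randomized approximation scheme (fpras) for estimating the number of copies of $H$ in a random graph $G\in\mathcal{G}(n,p)$.
   Context: $\mathcal{G}(n,p)$ denotes the Erdős–Rényi random graph on a fixed set of $n$ vertices in which each of the $\binom{n}{2}$ possible edges is present independently with probability $p$. The number of copies of $K_k$ in $G$ is the number of $k$-element vertex subsets of $G$ that induce a complete graph. An fpras for this counting problem (in the random-graph sense used here) is a randomized algorithm that, given a graph $G$ on $n$ vertices and $\varepsilon>0$, runs in time polynomial in $n$ and $\varepsilon^{-1}$ and, for graphs $G$ sampled from $\mathcal{G}(n,p)$, returns an answer within relative error $(1\pm\varepsilon)$ of the true count with high probability (probability tending to $1$ as $n\to\infty$). *)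

(* Defs.v *)
From HB Require Import structures.
From mathcomp Require Import all_boot all_order all_algebra.
From mathcomp Require Import all_classical all_reals all_analysis.
Import Order.TTheory GRing.Theory Num.Theory.
Import numFieldNormedType.Exports.

Set Implicit Arguments.
Unset Strict Implicit.
Unset Printing Implicit Defensive.

(** * Graphs, cliques, and the random graph G(n,p) *)

Definition pairs (n : nat) : {set {set 'I_n}} := [set e : {set 'I_n} | #|e| == 2].

Definition graph (n : nat) := {E : {set {set 'I_n}} | E \subset pairs n}.

Definition edge (n : nat) (G : graph n) (i j : 'I_n) : bool :=
  [set i; j] \in val G.

Definition is_clique (n : nat) (G : graph n) (V : {set 'I_n}) : bool :=
  [forall i in V, forall j in V, (i != j) ==> edge G i j].

Definition num_cliques (n k : nat) (G : graph n) : nat :=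
  #|[set V : {set 'I_n} | (#|V| == k) && is_clique G V]|.

(* Probability mass of G under G(n,p): each of the 'C(n, 2) possible edges is
   an independent Bernoulli variable of parameter p. *)
Definition gnp (R : realType) (n : nat) (p : R) (G : graph n) : R :=
  (\prod_(e in pairs n) (if e \in val G then p else 1 - p))%R.

(** * Randomized algorithms

   Algorithms are programs of a structured random access machine with fair
   coin flips.  The memory is an infinite array of natural numbers.  Running
   time follows the logarithmic cost criterion: every operation is charged the
   bit lengths of its operands and of the addresses used, so that polynomial
   time on this machine coincides with polynomial time on probabilistic Turing
   machines, although registers are unbounded and products are primitive. *)

Definition store := nat -> nat.

Inductive binop := OpAdd | OpSub | OpMul | OpDiv.

Inductive expr :=
| Cst of nat
| Get of expr
| Bin of binop & expr & expr.

Inductive cmd :=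
| Assign of expr & expr
| Flip of expr
| Seq of cmd & cmd
| Cond of expr & cmd & cmd
| While of expr & cmd.

Definition binop_sem (o : binop) : nat -> nat -> nat :=
  match o with OpAdd => addn | OpSub => subn | OpMul => muln | OpDiv => divn end.

Fixpoint eval (m : store) (e : expr) : nat :=
  match e with
  | Cst x => x
  | Get a => m (eval m a)
  | Bin o a b => binop_sem o (eval m a) (eval m b)
  end.

(* Bit length, with bitlen 0 = 1. *)
Definition bitlen (x : nat) : nat := (trunc_log 2 x).+1.

Fixpoint ecost (m : store) (e : expr) : nat :=
  match e with
  | Cst x => bitlen x
  | Get a => ecost m a + bitlen (eval m a) + bitlen (m (eval m a))
  | Bin _ a b => ecost m a + ecost m b + bitlen (eval m a) + bitlen (eval m b)
  end.

Definition upd (m : store) (a v : nat) : store := [eta m with a |-> v].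

(* [todo] is the stack of commands still to be executed; the machine has
   halted when it is empty.  [time] is the cost spent so far. *)
Record state := State { todo : seq cmd; memory : store; time : nat }.

(* One transition.  Every step is offered a fresh coin [b], which only [Flip]
   looks at.  A step of a machine that has not halted costs at least 1. *)
Definition step (s : state) (b : bool) : state :=
  let m := memory s in
  let t := time s in
  match todo s with
  | [::] => s
  | Assign a e :: r =>
      State r (upd m (eval m a) (eval m e))
        (t + ecost m a + ecost m e + bitlen (eval m a) + bitlen (eval m e))
  | Flip a :: r =>
      State r (upd m (eval m a) b) (t + ecost m a + bitlen (eval m a) + 1)
  | Seq c1 c2 :: r => State [:: c1, c2 & r] m (t + 1)
  | Cond e c1 c2 :: r =>
      State ((if eval m e != 0 then c1 else c2) :: r) m
        (t + ecost m e + bitlen (eval m e))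
  | While e c :: r =>
      State (if eval m e != 0 then [:: c, While e c & r] else r) m
        (t + ecost m e + bitlen (eval m e))
  end.

(* The state reached from memory [m] after [size w] transitions, using the
   coins [w]. *)
Definition exec (P : cmd) (m : store) (w : seq bool) : state :=
  foldl step (State [:: P] m 0) w.

(* The real eps > 0 is presented to a machine as the least natural number q
   with 1 / q < eps; thus prec eps <= 1 / eps + 1. *)
Definition prec (R : realType) (eps : R) : nat := (Num.truncn (eps^-1)%R).+1.

(* Initial memory: n, the size k of the clique to be counted, the accuracy q,
   then the n x n adjacency matrix of G, row by row, then zeros. *)
Definition input (n : nat) (G : graph n) (k q : nat) : store := fun a =>
  match a with
  | 0 => n
  | 1 => k
  | 2 => q
  | a'.+3 => [exists i : 'I_n, exists j : 'I_n, (a' == i * n + j) && edge G i j]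
  end.

(* The answer is the nonnegative rational whose numerator and denominator are
   found in cells 0 and 1. *)
Definition output (R : realType) (s : state) : R :=
  ((memory s 0)%:R / (memory s 1)%:R)%R.

(** * Approximation schemes on G(n,p) *)

Definition accurate (R : realType) (eps x y : R) : bool :=
  ((1 - eps) * x <= y <= (1 + eps) * x)%R.

(* Probability, over G in G(n,p) and T independent fair coins, that the run
   with accuracy eps approximates the number of k-cliques of G. *)
Definition success_prob (R : realType) (p : R) (P : cmd) (n k T : nat) (eps : R)
    : R :=
  (\sum_(G : graph n) gnp p G *
     (#|[set w : T.-tuple bool |
         accurate eps (num_cliques k G)%:R
           (output R (exec P (input G k (prec eps)) w))]|%:R / 2 ^+ T))%R.

Definition budget (R : realType) (c n : nat) (eps : R) : nat :=
  c * (n + prec eps) ^ c.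

(* P is an fpras for the number of copies of K_(k n) in G(n,p).  Halting within
   polynomial time is required for every graph, every eps > 0 and all coins; as
   a step costs at least 1, a time budget of T leaves room for at most T coin
   flips.  The accuracy eps may vary arbitrarily with n, i.e. the success
   probability tends to 1 uniformly in eps > 0: for a fixed eps only, a time
   bound polynomial in 1 / eps would carry no information. *)
Definition is_fpras_cliques (R : realType) (p : R) (k : nat -> nat) (P : cmd)
    : Prop :=
  exists c : nat,
    (forall (n : nat) (G : graph n) (eps : R), (0 < eps)%R ->
       forall w : (budget c n eps).-tuple bool,
         let s := exec P (input G (k n) (prec eps)) w in
         todo s = [::] /\ time s <= budget c n eps)
    /\
    (forall eps : nat -> R, (forall n, (0 < eps n)%R) ->
       (fun n => success_prob p P n (k n) (budget c n (eps n)) (eps n)) @ \oo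
         --> (1%R : R))%classic.

(* Main.v *)
(** Let N_w be the number of w-cliques of G, q = 2 N_2 / (n (n - 1)) its edge
    density, and f(w) = N_w / (C(n, w) q^C(w, 2)).  Although N_k fluctuates
    around its mean by a relative amount of order 1/n, f is close to a
    polynomial of low degree.  Indeed, with y_e = [e in G] / p - 1,

      N_w / (C(n, w) p^C(w, 2)) = sum_i C(w, i) alpha_i,

    where C(n, i) alpha_i is the sum, over the edge sets S covering exactly i
    vertices, of prod_(e in S) y_e.  These products are orthogonal, and so the
    second moment of C(k, i) alpha_i is at most
    C(k, i)^2 p^(-C(i, 2)) / C(n, i) <= n^(-i / 3): with high probability
    C(k, i) |alpha_i| <= b^i for all 0 < i <= k, where b = n^(-1 / 12).
    Replacing p by q = p (1 + alpha_2), which avoids any knowledge of p,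
    multiplies this sum by (1 + d)^C(w, 2) with d = O(alpha_2); expanded in powers
    of d, this factor raises the degree in w by 2 per power, at the cost of b^2.

    The algorithm is deterministic: it counts the w-cliques for all w <= D by
    enumerating the w-tuples of vertices, interpolates f polynomially at the
    nodes 0, .., D and evaluates the interpolant at k.  The relative error is at
    most b^D / 4, and it vanishes for D = k.  Hence the least D with n^D >= Q^12,
    Q being just above 1/eps, or D = k if that is smaller, is accurate enough,
    and the enumeration takes n^D <= n Q^12 steps. *)

Require Import Defs.
From mathcomp Require Import all_boot all_order all_algebra.
From mathcomp Require Import all_classical all_reals all_analysis.
From mathcomp Require Import zify ring lra.
Import Order.TTheory GRing.Theory Num.Theory.
Import numFieldNormedType.Exports.

Set Implicit Arguments.
Unset Strict Implicit.
Unset Printing Implicit Defensive.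

(** * Programs with bounded loops and their running time *)

Lemma bitlen_gt x : x < 2 ^ bitlen x.
Proof. exact: trunc_log_ltn. Qed.

Lemma bitlen_leP x l : 0 < l -> x < 2 ^ l -> bitlen x <= l.
Proof.
case: l => // l _ xl; rewrite /bitlen ltnS.
case: x xl => [|x] xl; first by rewrite trunc_log0.
have := trunc_logP (isT : 1 < 2) (ltn0Sn x).
by move=> H; rewrite -ltnS -(ltn_exp2l _ _ (isT : 1 < 2)); exact: leq_ltn_trans xl.
Qed.

Lemma bitlen_le x Y : 0 < Y -> x <= Y -> bitlen x <= Y.
Proof.
by move=> Y0 xY; apply: bitlen_leP => //; apply: leq_ltn_trans xY _; exact: ltn_expl.
Qed.

(** A product is the worst case: both [2 ^ bitlen a] and [2 ^ bitlen b] are at least 2, so their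
    product also bounds a sum. *)
Lemma bitlen_binop o a b : bitlen (binop_sem o a b) <= bitlen a + bitlen b.
Proof.
apply: bitlen_leP; first by rewrite /bitlen.
have la := bitlen_gt a; have lb := bitlen_gt b.
have h1 : 2 ^ bitlen a >= 2 by rewrite /bitlen expnS; have := expn_gt0 2 (trunc_log 2 a); lia.
have h2 : 2 ^ bitlen b >= 2 by rewrite /bitlen expnS; have := expn_gt0 2 (trunc_log 2 b); lia.
rewrite expnD; case: o => /=; [nia|nia|nia|].
by have := leq_div a b; nia.
Qed.

Lemma upd_eq m a v : upd m a v a = v.
Proof. by rewrite /upd /= eqxx. Qed.

Lemma upd_ne m a v x : (x != a) -> upd m a v x = m x.
Proof. by rewrite /upd /= => /negPf ->. Qed.

(** Quantifying over the stack, the starting time and the coins makes runs composable and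
    deterministic. The number of steps is bounded along with the cost because [exec] takes one step
    per coin. *)
Definition runs (c : cmd) (m m' : store) (T : nat) :=
  exists s t, [/\ s <= T, t <= T &
    forall r t0 w, size w = s ->
      foldl step (State (c :: r) m t0) w = State r m' (t0 + t)].

Lemma runs_le c m m' T T' : T <= T' -> runs c m m' T -> runs c m m' T'.
Proof.
move=> TT' [s [t [sT tT H]]]; exists s, t; split=> //; exact: leq_trans TT'.
Qed.

Lemma runs_assign m a e T :
  0 < T -> ecost m a + ecost m e + bitlen (Defs.eval m a) + bitlen (Defs.eval m e) <= T ->
  runs (Assign a e) m (upd m (Defs.eval m a) (Defs.eval m e)) T.
Proof.
move=> T0 HT; exists 1, (ecost m a + ecost m e + bitlen (Defs.eval m a) + bitlen (Defs.eval m e)).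
split=> // r t0 [|b [|? ?]] //= _.
by rewrite /step /= !addnA.
Qed.

Lemma runs_seq c1 c2 m1 m2 m3 T1 T2 :
  runs c1 m1 m2 T1 -> runs c2 m2 m3 T2 -> runs (Seq c1 c2) m1 m3 (T1 + T2).+1.
Proof.
move=> [s1 [t1 [l1 l1' H1]]] [s2 [t2 [l2 l2' H2]]].
exists (s1 + s2).+1, (t1 + t2).+1; split; [lia|lia|].
move=> r t0 [|b w] //= [sw].
rewrite -(cat_take_drop s1 w) foldl_cat H1; last by rewrite size_take; case: ifP => *; lia.
rewrite H2; last by rewrite size_drop; lia.
by congr State; rewrite /=; lia.
Qed.

(** The guard counts the remaining iterations, so it vanishes exactly after [N] of them. Since
    [0 < C], the bound [C] on a guard test also covers its single transition. *)
Lemma runs_while e c (inv : nat -> store -> Prop) N T C m :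
  (forall i m, i < N -> inv i m -> exists2 m', inv i.+1 m' & runs c m m' T) ->
  (forall i m, i <= N -> inv i m -> Defs.eval m e = N - i) ->
  (forall i m, i <= N -> inv i m -> ecost m e + bitlen (Defs.eval m e) <= C) ->
  0 < C -> inv 0 m ->
  exists2 m', inv N m' & runs (While e c) m m' (N * (T + C) + C).
Proof.
move=> Hc He HC C0.
(* Induction on the number [j] of iterations still to come. *)
suff: forall j m, j <= N -> inv (N - j) m ->
    exists2 m', inv N m' & runs (While e c) m m' (j * (T + C) + C).
  by move=> /(_ N m (leqnn N)); rewrite subnn.
elim=> [|j IH] {}m jN Im.
  rewrite subn0 in Im; exists m => //.
  exists 1, (ecost m e + bitlen (Defs.eval m e)).
  split; [lia|have := HC N m (leqnn N) Im; lia|].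
  move=> r t0 [|b [|? ?]] //= _.
  by rewrite /step /= (He N) // subnn eqxx /= addnA.
have lN : N - j.+1 < N by lia.
have NE : (N - j.+1).+1 = N - j by lia.
have [m1 I1 [s2 [t2 [l2 l2' H2]]]] := Hc _ _ lN Im.
rewrite NE in I1; have [m' I' [s1 [t1 [l1 l1' H1]]]] := IH _ (ltnW jN) I1.
exists m' => //.
exists (s2 + s1).+1, (ecost m e + bitlen (Defs.eval m e) + (t2 + t1)).
have HCC := HC _ _ (ltnW lN) Im.
split; [lia|nia|].
move=> r t0 [|b w] //= [sw].
have nz : Defs.eval m e != 0 by rewrite (He _ _ (ltnW lN) Im); lia.
have -> : step (State (While e c :: r) m t0) b =
  State [:: c, While e c & r] m (t0 + ecost m e + bitlen (Defs.eval m e)).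
  by rewrite /step /= nz.
rewrite -(cat_take_drop s2 w) foldl_cat H2; last by rewrite size_take; case: ifP => *; lia.
rewrite H1 ?size_drop; last lia.
by congr State; lia.
Qed.

(* Variables are de Bruijn indices of loop counters, [HIn] reads an input cell, and
   [HFold o z b e] combines the values of [e] for all indices below [b] by [o],
   starting from [z]. *)
Inductive hexp :=
| HC of nat
| HV of nat
| HIn of hexp
| HBin of binop & hexp & hexp
| HFold of binop & nat & hexp & hexp.

Fixpoint sem (inp : store) (rho : seq nat) (e : hexp) : nat :=
  match e with
  | HC x => x
  | HV i => nth 0 rho i
  | HIn a => inp (sem inp rho a)
  | HBin o a b => binop_sem o (sem inp rho a) (sem inp rho b)
  | HFold o z b e =>
      iteri (sem inp rho b) (fun i acc => binop_sem o acc (sem inp (i :: rho) e)) z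
  end.

(* The registers lie above the input, which occupies the cells below 3 + n * n. *)
Definition basee : expr :=
  Bin OpAdd (Cst 3) (Bin OpMul (Get (Cst 0)) (Get (Cst 0))).
Definition reg (d : nat) : expr := Bin OpAdd basee (Cst d).

(** The value of [e] ends up in register [d]; lower registers are left untouched, and [vs] lists
    those among them that hold the loop counters in scope. A fold keeps its bound, counter and
    accumulator in registers [d], [d.+1] and [d.+2] and works above them. *)
Fixpoint compile (vs : seq nat) (d : nat) (e : hexp) : cmd :=
  match e with
  | HC x => Assign (reg d) (Cst x)
  | HV i => Assign (reg d) (Get (reg (nth 0 vs i)))
  | HIn a => Seq (compile vs d a) (Assign (reg d) (Get (Get (reg d))))
  | HBin o a b =>
      Seq (compile vs d a) (Seq (compile vs d.+1 b)
        (Assign (reg d) (Bin o (Get (reg d)) (Get (reg d.+1)))))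
  | HFold o z b e =>
      Seq (compile vs d b) (Seq (Assign (reg d.+1) (Cst 0))
      (Seq (Assign (reg d.+2) (Cst z))
      (Seq (While (Bin OpSub (Get (reg d)) (Get (reg d.+1)))
              (Seq (compile (d.+1 :: vs) d.+3 e)
              (Seq (Assign (reg d.+2) (Bin o (Get (reg d.+2)) (Get (reg d.+3))))
                   (Assign (reg d.+1) (Bin OpAdd (Get (reg d.+1)) (Cst 1))))))
           (Assign (reg d) (Get (reg d.+2))))))
  end.

Fixpoint nregs (e : hexp) : nat :=
  match e with
  | HC _ => 1
  | HV _ => 1
  | HIn a => nregs a
  | HBin _ a b => nregs a + (nregs b).+1
  | HFold _ _ b e => nregs b + (nregs e).+3
  end.

(* If no loop has more than [Y] iterations, then values have bit length at most
   [Y ^ (height e).-2], and running times are at most [Y ^ height e]. *)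
Fixpoint height (e : hexp) : nat :=
  match e with
  | HC _ => 3
  | HV _ => 3
  | HIn a => height a + 3
  | HBin _ a b => height a + height b + 3
  | HFold _ _ b e => height b + height e + 6
  end.

Definition msize (inp : store) := (inp 0 * inp 0).+3.

(** Registers are indexed relative to the end of the input, so that updating [env] never touches the
    input. *)
Definition layout (inp : store) (env : store) : store :=
  fun a => if a < msize inp then inp a else env (a - msize inp).

(** Constants and loop lengths must not exceed [Y]; other values may be far larger, only their bit
    lengths being controlled. Reads are confined to the input region because registers occupy the
    memory above it. *)
Fixpoint ok (inp : store) (Y : nat) (rho : seq nat) (e : hexp) : Prop :=
  match e with
  | HC x => x <= Y
  | HV i => i < size rho
  | HIn a => ok inp Y rho a /\ sem inp rho a < msize inp
  | HBin o a b => ok inp Y rho a /\ ok inp Y rho b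
  | HFold o z b e => [/\ ok inp Y rho b, z <= Y, sem inp rho b <= Y &
      forall i, i < sem inp rho b -> ok inp Y (i :: rho) e]
  end.

(** * Correctness and cost of compiled expressions *)

Section Compiler.
Variables (inp : store) (Y : nat).
Hypothesis (Y128 : 128 <= Y) (inpY : forall a, inp a <= Y) (baseY : msize inp <= Y).

Let Y0 : 0 < Y. Proof. lia. Qed.

Lemma height_ge3 e : 3 <= height e.
Proof. by elim: e => //= *; lia. Qed.

Lemma leqYX i j : i <= j -> Y ^ i <= Y ^ j.
Proof. by move=> ij; rewrite leq_pexp2l. Qed.

(** Each operation, even a multiplication, adds at most [V] bits. *)
Lemma bitlen_iteri o z N g V : bitlen z <= V -> (forall i, i < N -> bitlen (g i) <= V) ->
  bitlen (iteri N (fun i acc => binop_sem o acc (g i)) z) <= N.+1 * V.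
Proof.
elim: N => [|N IH] hz hg /=; first by rewrite mul1n.
apply: leq_trans (bitlen_binop _ _ _) _.
have := IH hz (fun i iN => hg i (ltnW iN)).
have := hg N (ltnSn N); nia.
Qed.

Lemma sem_bitlen e rho : all (fun x => x <= Y) rho -> ok inp Y rho e ->
  bitlen (sem inp rho e) <= Y ^ (height e).-2.
Proof.
elim: e rho => [x|i|a IH|o a IHa b IHb|o z b IHb e IHe] rho hr /=.
- by move=> xY; rewrite expn1; exact: bitlen_le.
- move=> ir; rewrite expn1; apply: bitlen_le => //.
  by move/(all_nthP 0): hr; apply.
- move=> [oa _]; apply: (@leq_trans Y); first exact: bitlen_le.
  by rewrite -{1}(expn1 Y) leqYX //; have := height_ge3 a; lia.
- move=> [oa ob]; apply: leq_trans (bitlen_binop _ _ _) _.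
  have la := IHa _ hr oa; have lb := IHb _ hr ob.
  have ha := height_ge3 a; have hb := height_ge3 b.
  apply: (@leq_trans (2 * Y ^ (height a + height b))); last first.
    have -> : (height a + height b + 3).-2 = (height a + height b).+1 by lia.
    by rewrite expnS leq_mul2r; apply/orP; right; lia.
  have := leqYX (_ : (height a).-2 <= height a + height b).
  have := leqYX (_ : (height b).-2 <= height a + height b).
  by move=> /(_ ltac:(lia)) ? /(_ ltac:(lia)) ?; lia.
- move=> [ob zY bY oe].
  have he := height_ge3 e; have hb := height_ge3 b.
  apply: leq_trans (@bitlen_iteri _ _ _ _ (Y ^ height e) _ _) _.
  + apply: (@leq_trans Y); first exact: bitlen_le.
    by rewrite -{1}(expn1 Y) leqYX //; lia.
  + move=> i ib; apply: (@leq_trans (Y ^ (height e).-2)).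
      by apply: IHe; rewrite /= ?hr ?andbT; [lia|exact: oe].
    by apply: leqYX; lia.
  + apply: (@leq_trans (Y ^ (height e).+2)); last by apply: leqYX; lia.
    rewrite !expnS mulnA leq_mul2r; apply/orP; right.
    by apply: (@leq_trans (Y.+1)); [lia|nia].
Qed.

Lemma layout0 env : layout inp env 0 = inp 0.
Proof. by rewrite /layout /msize. Qed.

Lemma layout_reg env d : layout inp env (msize inp + d) = env d.
Proof. by rewrite /layout ltnNge leq_addr /= addKn. Qed.

Lemma layout_inp env a : a < msize inp -> layout inp env a = inp a.
Proof. by rewrite /layout => ->. Qed.

Lemma upd_layout env d v :
  upd (layout inp env) (msize inp + d) v = layout inp (upd env d v).
Proof.
apply: boolp.funext => a; rewrite /upd /layout /=.
case: ltnP => aS; first by case: eqP => //; lia.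
case: eqP => [->|ne]; first by rewrite addKn eqxx.
by case: eqP => //; lia.
Qed.

Lemma eval_reg env d : Defs.eval (layout inp env) (reg d) = msize inp + d.
Proof. by rewrite /= layout0 /msize; lia. Qed.

Lemma eval_get env d : Defs.eval (layout inp env) (Get (reg d)) = env d.
Proof.
have -> : Defs.eval (layout inp env) (Get (reg d)) =
  layout inp env (Defs.eval (layout inp env) (reg d)) by [].
by rewrite eval_reg layout_reg.
Qed.

Lemma ecost_reg env d : msize inp + d <= Y -> ecost (layout inp env) (reg d) <= 14 * Y.
Proof.
move=> dY; rewrite /= layout0.
have b0 : bitlen 0 <= Y by apply: bitlen_le.
have b3 : bitlen 3 <= Y by apply: bitlen_le => //; lia.
have bn : bitlen (inp 0) <= Y by apply: bitlen_le.
have bnn : bitlen (inp 0 * inp 0) <= Y by apply: bitlen_le => //; move: dY; rewrite /msize; lia.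
have bnn3 : bitlen (3 + inp 0 * inp 0) <= Y by apply: bitlen_le => //; move: dY; rewrite /msize; lia.
have bd : bitlen d <= Y by apply: bitlen_le => //; lia.
lia.
Qed.

Lemma ecost_get env d V : msize inp + d <= Y -> bitlen (env d) <= V ->
  ecost (layout inp env) (Get (reg d)) <= 15 * Y + V.
Proof.
move=> dY bV.
have -> : ecost (layout inp env) (Get (reg d)) =
  ecost (layout inp env) (reg d) + bitlen (Defs.eval (layout inp env) (reg d))
  + bitlen (Defs.eval (layout inp env) (Get (reg d))) by [].
rewrite eval_get eval_reg.
have := ecost_reg env dY; have : bitlen (msize inp + d) <= Y by exact: bitlen_le.
lia.
Qed.

Lemma runs_set env d e v V : msize inp + d <= Y -> Defs.eval (layout inp env) e = v ->
  ecost (layout inp env) e + bitlen v <= V ->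
  runs (Assign (reg d) e) (layout inp env) (layout inp (upd env d v)) (15 * Y + V).
Proof.
move=> dY ev cV; rewrite -upd_layout -ev -(eval_reg env d).
apply: runs_assign; first lia.
rewrite eval_reg ev.
have := ecost_reg env dY; have : bitlen (msize inp + d) <= Y by exact: bitlen_le.
lia.
Qed.


Lemma nregs_gt0 e : 0 < nregs e.
Proof. by elim: e => //= *; lia. Qed.

(** Spare factors of [Y] absorb the constant overhead of register accesses; this is what the
    additive constants in [height] are for. *)
Lemma expY g : 128 * Y ^ g <= Y ^ g.+1.
Proof. by rewrite expnS leq_mul2r Y128 orbT. Qed.

(** Induction on [e]. Preservation of the registers below [d] keeps enclosing loop counters and
    operands already computed valid while a subexpression is evaluated. *)
Lemma compileP e vs d env rho :
  size vs = size rho -> all (fun x => x <= Y) rho -> ok inp Y rho e ->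
  all (fun i => i < d) vs -> map env vs = rho -> msize inp + d + nregs e <= Y ->
  exists env', [/\ runs (compile vs d e) (layout inp env) (layout inp env') (Y ^ height e),
    forall i, i < d -> env' i = env i & env' d = sem inp rho e].
Proof.
elim: e vs d env rho => [x|i|a IH|o a IHa b IHb|o z b IHb e IHe] vs d env rho svs hr oe vsd evs dY.
- exists (upd env d x); split=> [||]; last by rewrite /upd /= eqxx.
    apply: runs_le (runs_set (v := x) (V := 2 * Y) _ _ _) => //=; [|by move: dY => /=; lia|].
      by rewrite /= !expnS expn0; nia.
    by have : bitlen x <= Y by [exact: bitlen_le]; lia.
  by move=> i id; rewrite /upd /=; case: eqP => //; lia.
- have ird : nth 0 vs i < d by move/(all_nthP 0): vsd; apply; rewrite svs.
  have ev : env (nth 0 vs i) = nth 0 rho i by rewrite -evs (nth_map 0) // svs.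
  have iY : nth 0 rho i <= Y by move/(all_nthP 0): hr; apply.
  have bY : bitlen (nth 0 rho i) <= Y by exact: bitlen_le.
  exists (upd env d (nth 0 rho i)); split=> [||]; last by rewrite /upd /= eqxx.
    move: dY => /= dY.
    apply: runs_le (runs_set (V := 18 * Y) _ _ _) => //; first 2 last.
    + by rewrite -ev eval_get.
    + by have := @ecost_get env (nth 0 vs i) Y; rewrite ev => /(_ ltac:(lia) bY); lia.
    + by rewrite /= !expnS expn0; nia.
    + by lia.
  by move=> j jd; rewrite /upd /=; case: eqP => //; lia.
- have [oa aS] := oe.
  have [env1 [r1 f1 v1]] := IH vs d env rho svs hr oa vsd evs dY.
  have ba := sem_bitlen hr oa.
  have ha := height_ge3 a; have ga := nregs_gt0 a; move: dY => /= dY.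
  exists (upd env1 d (inp (sem inp rho a))); split=> [||].
  + apply: runs_le (runs_seq r1 (runs_set (V := 20 * Y ^ height a) _ _ _)); first 2 last.
    * rewrite -v1.
      have -> : Defs.eval (layout inp env1) (Get (Get (reg d))) =
        layout inp env1 (Defs.eval (layout inp env1) (Get (reg d))) by [].
      by rewrite eval_get v1 layout_inp.
    * have -> : ecost (layout inp env1) (Get (Get (reg d))) =
        ecost (layout inp env1) (Get (reg d)) +
        bitlen (Defs.eval (layout inp env1) (Get (reg d))) +
        bitlen (layout inp env1 (Defs.eval (layout inp env1) (Get (reg d)))) by [].
      rewrite eval_get v1 layout_inp //.
      have := @ecost_get env1 d (Y ^ (height a).-2); rewrite v1 => /(_ ltac:(lia) ba).
      have bi : bitlen (inp (sem inp rho a)) <= Y by exact: bitlen_le.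
      have := @leqYX 1 (height a) ltac:(lia); rewrite expn1.
      have := @leqYX (height a).-2 (height a) ltac:(lia).
      lia.
    * rewrite addn3; have := @leqYX 1 (height a) ltac:(lia); rewrite expn1.
      have := expY (height a); have := expY (height a).+1; have := expY (height a).+2.
      by lia.
    * by lia.
  + by move=> i id; rewrite /upd /=; case: eqP => [|_]; [lia|exact: f1].
  + by rewrite /upd /= eqxx.
- have [oa ob] := oe; move: dY => /= dY.
  have ga := nregs_gt0 a; have gb := nregs_gt0 b.
  have ha := height_ge3 a; have hb := height_ge3 b.
  have [env1 [r1 f1 v1]] := IHa vs d env rho svs hr oa vsd evs ltac:(lia).
  have vsd1 : all (fun i => i < d.+1) vs by apply: sub_all vsd => i; lia.
  have evs1 : map env1 vs = rho.
    by rewrite -evs; apply/eq_in_map => i /(allP vsd); exact: f1.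
  have [env2 [r2 f2 v2]] := IHb vs d.+1 env1 rho svs hr ob vsd1 evs1 ltac:(lia).
  have ba := sem_bitlen hr oa; have bb := sem_bitlen hr ob.
  have v2d : env2 d = sem inp rho a by rewrite f2 ?v1 //; lia.
  set g := height a + height b.
  have bba := bitlen_binop o (sem inp rho a) (sem inp rho b).
  have p1 := @leqYX 1 g ltac:(lia); rewrite expn1 in p1.
  have p2 := @leqYX (height a).-2 g ltac:(lia).
  have p3 := @leqYX (height b).-2 g ltac:(lia).
  have p4 := @leqYX (height b) g ltac:(lia).
  have p5 := @leqYX (height a) g ltac:(lia).
  exists (upd env2 d (sem inp rho (HBin o a b))); split=> [||].
  + apply: runs_le (runs_seq r1 (runs_seq r2 (runs_set (V := 36 * Y ^ g) _ _ _))); first 2 last.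
    * by rewrite [RHS]/= -v2 -v2d -!(eval_get env2).
    * have -> : ecost (layout inp env2) (Bin o (Get (reg d)) (Get (reg d.+1))) =
        ecost (layout inp env2) (Get (reg d)) + ecost (layout inp env2) (Get (reg d.+1)) +
        bitlen (Defs.eval (layout inp env2) (Get (reg d))) +
        bitlen (Defs.eval (layout inp env2) (Get (reg d.+1))) by [].
      rewrite !eval_get v2 v2d [sem _ _ (HBin _ _ _)]/=.
      have := @ecost_get env2 d (Y ^ g); rewrite v2d => /(_ ltac:(lia) ltac:(lia)).
      have := @ecost_get env2 d.+1 (Y ^ g); rewrite v2 => /(_ ltac:(lia) ltac:(lia)).
      lia.
    * by rewrite /= -/g addn3; have := expY g; have := expY g.+1; have := expY g.+2; lia.
    * by lia.
  + by move=> i id; rewrite /upd /=; case: eqP => [|_]; [lia|rewrite f2 ?f1 //; lia].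
  + by rewrite /upd /= eqxx.
- have [ob zY bY oe'] := oe; move: dY => /= dY.
  have gb := nregs_gt0 b; have ge := nregs_gt0 e.
  have hb := height_ge3 b; have he := height_ge3 e.
  have [env1 [r1 f1 v1]] := IHb vs d env rho svs hr ob vsd evs ltac:(lia).
  set N := sem inp rho b in v1 bY oe' *.
  pose acc i := iteri i (fun i x => binop_sem o x (sem inp (i :: rho) e)) z.
  set g := height b + height e.
  pose V := Y ^ g.
  have p1 : Y <= V by have := @leqYX 1 g ltac:(lia); rewrite expn1.
  have p2 : Y ^ height e <= V by apply: leqYX; lia.
  have p3 : Y ^ height b <= V by apply: leqYX; lia.
  have p4 : Y * Y ^ (height e).-2 <= V by rewrite -expnS; apply: leqYX; lia.
  have bz : bitlen z <= Y by exact: bitlen_le.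
  have be i : i < N -> bitlen (sem inp (i :: rho) e) <= Y ^ (height e).-2.
    by move=> iN; apply: sem_bitlen; [rewrite /= hr andbT; lia|exact: oe'].
  have bacc i : i <= N -> bitlen (acc i) <= V.
    move=> iN; apply: leq_trans (@bitlen_iteri _ _ _ _ (Y ^ height e) _ _) _.
    - by have := @leqYX 1 (height e) ltac:(lia); rewrite expn1; lia.
    - by move=> j ji; have := be j ltac:(lia); have := @leqYX (height e).-2 (height e) ltac:(lia); lia.
    have := @leqYX (height e).+2 g ltac:(lia); rewrite -/V !expnS mulnA => H.
    by apply: leq_trans H; rewrite leq_mul2r; apply/orP; right; nia.
  have bi i : i <= N -> bitlen i <= Y by move=> iN; apply: bitlen_le => //; lia.
  pose inv i m := exists env', [/\ m = layout inp env', forall j, j < d -> env' j = env j,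
    env' d = N, env' d.+1 = i & env' d.+2 = acc i].
  pose env3 := upd (upd env1 d.+1 0) d.+2 z.
  have inv0 : inv 0 (layout inp env3).
    exists env3; split=> //; rewrite /env3.
    - by move=> j jd; rewrite !upd_ne ?f1 //; lia.
    - by rewrite !upd_ne //; lia.
    - by rewrite upd_ne ?upd_eq //; lia.
    - by rewrite upd_eq.
  have body i m : i < N -> inv i m -> exists2 m', inv i.+1 m' & runs
      (Seq (compile (d.+1 :: vs) d.+3 e)
      (Seq (Assign (reg d.+2) (Bin o (Get (reg d.+2)) (Get (reg d.+3))))
           (Assign (reg d.+1) (Bin OpAdd (Get (reg d.+1)) (Cst 1))))) m m' (110 * V).
    move=> iN [env' [-> g1 gd gd1 gd2]].
    have vs3 : all (fun i => i < d.+3) (d.+1 :: vs).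
      by rewrite /= ltnS leqnSn /=; apply: sub_all vsd => j; lia.
    have evs3 : map env' (d.+1 :: vs) = i :: rho.
      rewrite /= gd1 -evs; congr cons.
      by apply/eq_in_map => j /(allP vsd); exact: g1.
    have hri : all (fun x => x <= Y) (i :: rho) by rewrite /= hr andbT; lia.
    have [env4 [r4 f4 v4]] := IHe (d.+1 :: vs) d.+3 env' (i :: rho)
      (congr1 succn svs) hri (oe' _ iN) vs3 evs3 ltac:(lia).
    pose env5 := upd env4 d.+2 (acc i.+1).
    have accS : acc i.+1 = binop_sem o (env4 d.+2) (env4 d.+3).
      by rewrite f4 // gd2 v4.
    have h2 : env4 d.+2 = acc i by rewrite f4.
    have h1 : env5 d.+1 = i by rewrite /env5 upd_ne ?f4 //; lia.
    exists (layout inp (upd env5 d.+1 i.+1)).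
      exists (upd env5 d.+1 i.+1); split=> //; rewrite /env5.
      - by move=> j jd; rewrite !upd_ne ?f4 ?g1 //; lia.
      - by rewrite !upd_ne ?f4 ?gd //; lia.
      - by rewrite upd_eq.
      - by rewrite upd_ne ?upd_eq //; lia.
    have c1 := bacc _ (ltnW iN); have c2 := bacc _ iN.
    have c3 := be _ iN; have c4 := @leqYX (height e).-2 g ltac:(lia).
    apply: runs_le (runs_seq r4 (runs_seq (runs_set (v := acc i.+1) (V := 36 * V) _ _ _)
      (runs_set (v := i.+1) (V := 20 * V) _ _ _))).
    - by move: p1 p2; rewrite -/V; lia.
    - by lia.
    - by rewrite accS -!(eval_get env4).
    - have -> : ecost (layout inp env4) (Bin o (Get (reg d.+2)) (Get (reg d.+3))) =
        ecost (layout inp env4) (Get (reg d.+2)) + ecost (layout inp env4) (Get (reg d.+3)) +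
        bitlen (Defs.eval (layout inp env4) (Get (reg d.+2))) +
        bitlen (Defs.eval (layout inp env4) (Get (reg d.+3))) by [].
      rewrite !eval_get h2 v4.
      have := @ecost_get env4 d.+2 V; rewrite h2 => /(_ ltac:(lia) ltac:(lia)).
      have := @ecost_get env4 d.+3 V; rewrite v4 => /(_ ltac:(lia) ltac:(lia)).
      by lia.
    - by lia.
    - have -> : Defs.eval (layout inp env5) (Bin OpAdd (Get (reg d.+1)) (Cst 1)) =
        Defs.eval (layout inp env5) (Get (reg d.+1)) + 1 by [].
      by rewrite eval_get h1 addn1.
    - have -> : ecost (layout inp env5) (Bin OpAdd (Get (reg d.+1)) (Cst 1)) =
        ecost (layout inp env5) (Get (reg d.+1)) + bitlen 1 +
        bitlen (Defs.eval (layout inp env5) (Get (reg d.+1))) + bitlen 1 by [].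
      rewrite eval_get h1.
      have := @ecost_get env5 d.+1 Y; rewrite h1 => /(_ ltac:(lia) (bi _ (ltnW iN))).
      have := bi _ (ltnW iN); have := bi _ iN; have : bitlen 1 <= Y by exact: bitlen_le.
      by lia.
  have test i m : i <= N -> inv i m ->
      Defs.eval m (Bin OpSub (Get (reg d)) (Get (reg d.+1))) = N - i.
    move=> iN [env' [-> _ gd gd1 _]].
    have -> : Defs.eval (layout inp env') (Bin OpSub (Get (reg d)) (Get (reg d.+1))) =
      Defs.eval (layout inp env') (Get (reg d)) - Defs.eval (layout inp env') (Get (reg d.+1)) by [].
    by rewrite !eval_get gd gd1.
  have testc i m : i <= N -> inv i m ->
      ecost m (Bin OpSub (Get (reg d)) (Get (reg d.+1))) +
      bitlen (Defs.eval m (Bin OpSub (Get (reg d)) (Get (reg d.+1)))) <= 40 * V.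
    move=> iN Im; rewrite (test _ _ iN Im); move: Im => [env' [-> _ gd gd1 _]].
    have -> : ecost (layout inp env') (Bin OpSub (Get (reg d)) (Get (reg d.+1))) =
      ecost (layout inp env') (Get (reg d)) + ecost (layout inp env') (Get (reg d.+1)) +
      bitlen (Defs.eval (layout inp env') (Get (reg d))) +
      bitlen (Defs.eval (layout inp env') (Get (reg d.+1))) by [].
    rewrite !eval_get gd gd1.
    have := @ecost_get env' d Y; rewrite gd => /(_ ltac:(lia) (bi _ (leqnn N))).
    have := @ecost_get env' d.+1 Y; rewrite gd1 => /(_ ltac:(lia) (bi _ iN)).
    have := bi _ iN; have := bi _ (leqnn N); have := bi _ (leq_subr i N).
    by lia.
  have [m' [env6 [-> k1 kd kd1 kd2]] rw] := runs_while body test testc ltac:(lia) inv0.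
  exists (upd env6 d (acc N)); split=> [||].
  + apply: runs_le (runs_seq r1 (runs_seq (runs_set (v := 0) (V := 2 * V) _ _ _)
      (runs_seq (runs_set (v := z) (V := 2 * V) _ _ _) (runs_seq rw
        (runs_set (v := acc N) (V := 20 * V) _ _ _))))).
    * have -> : g + 6 = g.+4.+2 by lia.
      have q1 : N * (110 * V + 40 * V) <= 150 * Y ^ g.+1 by rewrite expnS -/V; nia.
      have := expY g; have := expY g.+1; have := expY g.+2; have := expY g.+3.
      have := expY g.+4; have := expY g.+4.+1; rewrite -/V.
      by lia.
    * by lia.
    * by [].
    * by rewrite /=; have : bitlen 0 <= Y by [exact: bitlen_le]; lia.
    * by lia.
    * by [].
    * by rewrite /=; lia.
    * by lia.
    * by rewrite eval_get kd2.
    * have := @ecost_get env6 d.+2 V; rewrite kd2 => /(_ ltac:(lia) (bacc _ (leqnn N))).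
      have := bacc _ (leqnn N); lia.
  + by move=> j jd; rewrite /upd /=; case: eqP => [|_]; [lia|exact: k1].
  + by rewrite /upd /= eqxx.
Qed.

(** Register addresses are computed from cell 0, so the numerator must be copied there last. *)
Lemma runs_compile en ed :
  ok inp Y [::] en -> ok inp Y [::] ed -> msize inp + nregs en + nregs ed + 2 <= Y ->
  exists2 m', m' 0 = sem inp [::] en /\ m' 1 = sem inp [::] ed &
    runs (Seq (compile [::] 0 en) (Seq (compile [::] 1 ed)
      (Seq (Assign (Cst 1) (Get (reg 1))) (Assign (Cst 0) (Get (reg 0))))))
      inp m' (Y ^ (height en + height ed + 3)).
Proof.
move=> on od nY; have gn := nregs_gt0 en; have gd := nregs_gt0 ed.
have hn := height_ge3 en; have hd := height_ge3 ed.
pose env a := inp (msize inp + a).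
have inpE : layout inp env = inp.
  by apply: boolp.funext => a; rewrite /layout /env; case: ltnP => // la; rewrite subnKC.
have [env1 [r1 _ v1]] := @compileP en [::] 0 env [::] erefl isT on isT erefl ltac:(lia).
have [env2 [r2 f2 v2]] := @compileP ed [::] 1 env1 [::] erefl isT od isT erefl ltac:(lia).
have w0 : env2 0 = sem inp [::] en by rewrite f2 // v1.
rewrite inpE in r1.
have bn := @sem_bitlen en [::] isT on; have bd := @sem_bitlen ed [::] isT od.
set g := height en + height ed; pose V := Y ^ g.
have p1 : Y <= V by have := @leqYX 1 g ltac:(lia); rewrite expn1.
have p2 : Y ^ height en <= V by apply: leqYX; lia.
have p3 : Y ^ height ed <= V by apply: leqYX; lia.
have p4 : Y ^ (height en).-2 <= V by apply: leqYX; lia.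
have p5 : Y ^ (height ed).-2 <= V by apply: leqYX; lia.
have b0 : bitlen 0 <= Y by exact: bitlen_le.
have b1 : bitlen 1 <= Y by exact: bitlen_le.
(* After the first copy the memory is a layout over a modified input; the registers have not moved,
   since their base depends on cell 0 only. *)
pose inp' : store := upd inp 1 (env2 1).
have lE env' : upd (layout inp env') 1 (env2 1) = layout inp' env'.
  apply: boolp.funext => a; rewrite /layout (_ : msize inp' = msize inp) //.
  by case: (eqVneq a 1) => [->|ne]; rewrite /inp' ?upd_eq // !upd_ne.
have l0 : layout inp' env2 0 = layout inp env2 0 by [].
have addr : Defs.eval (layout inp' env2) (reg 0) = msize inp + 0.
  by rewrite -(eval_reg env2 0) /= l0.
have e0 : Defs.eval (layout inp' env2) (Get (reg 0)) = env2 0.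
  have -> : Defs.eval (layout inp' env2) (Get (reg 0)) =
    layout inp' env2 (Defs.eval (layout inp' env2) (reg 0)) by [].
  by rewrite addr /layout (_ : msize inp' = msize inp) // addn0 ltnn subnn.
exists (upd (layout inp' env2) 0 (env2 0)).
  split; first by rewrite upd_eq w0.
  by rewrite upd_ne // -(lE env2) upd_eq v2.

have c0 : ecost (layout inp' env2) (Get (reg 0)) = ecost (layout inp env2) (Get (reg 0)).
  have E m : ecost m (Get (reg 0)) = ecost m (reg 0) + bitlen (Defs.eval m (reg 0)) +
    bitlen (Defs.eval m (Get (reg 0))) by [].
  by rewrite !E e0 eval_get addr eval_reg /= l0.
have g0 := @ecost_get env2 0 V; rewrite w0 in g0.
have g1 := @ecost_get env2 1 V; rewrite v2 in g1.
have gg0 := g0 ltac:(lia) ltac:(lia).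
have gg1 := g1 ltac:(lia) ltac:(lia).
apply: runs_le (runs_seq r1 (runs_seq r2 (runs_seq (T1 := 30 * V) (T2 := 30 * V) (m2 := layout inp' env2) _ _))).
- have := expY g; have := expY g.+1; have := expY g.+2; rewrite -/V addn3; lia.
- rewrite -lE -(eval_get env2 1).
  apply: (@runs_assign _ (Cst 1)); first lia.
  rewrite eval_get v2 [Defs.eval _ (Cst 1)]/= [ecost _ (Cst 1)]/=; lia.
- rewrite -e0; apply: (@runs_assign _ (Cst 0)); first lia.
  by rewrite e0 c0 w0 [Defs.eval _ (Cst 0)]/= [ecost _ (Cst 0)]/=; lia.
Qed.

End Compiler.

Lemma foldl_step_halted m t w : foldl step (State [::] m t) w = State [::] m t.
Proof. by elim: w. Qed.

Lemma exec_runs c m m' T w : runs c m m' T -> T <= size w ->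
  exists2 t, t <= T & exec c m w = State [::] m' t.
Proof.
move=> [s [t [sT tT H]]] Tw; exists t => //.
rewrite /exec -(cat_take_drop s w) foldl_cat H ?foldl_step_halted ?add0n //.
by rewrite size_takel //; lia.
Qed.

(** * Counting cliques by enumerating tuples *)

Definition digit (n x i : nat) := (x %/ n ^ i) %% n.

Lemma digit_inj n w x y : x < n ^ w -> y < n ^ w ->
  (forall i, i < w -> digit n x i = digit n y i) -> x = y.
Proof.
elim: w x y => [|w IH] x y; first by rewrite expn0; lia.
move=> xn yn H.
have n0 : 0 < n by case: n xn {IH H yn} => //; rewrite exp0n.
rewrite (divn_eq x n) (divn_eq y n).
have := H 0 isT; rewrite /digit expn0 !divn1 => ->.
rewrite (IH (x %/ n) (y %/ n)) //.
- by rewrite ltn_divLR // -expnSr.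
- by rewrite ltn_divLR // -expnSr.
by move=> i iw; have := H i.+1 iw; rewrite /digit expnS -!divnMA.
Qed.

Lemma edge_irr n (G : graph n) i : edge G i i = false.
Proof.
apply/negP => H; have /fintype.subsetP /(_ _ H) := valP G.
by rewrite inE finset.setUid cards1.
Qed.

Lemma edge_sym n (G : graph n) i j : edge G i j = edge G j i.
Proof. by rewrite /edge finset.setUC. Qed.

Definition clique_tuple n (G : graph n) w (f : {ffun 'I_w -> 'I_n}) :=
  [forall j : 'I_w, forall i : 'I_w, (i < j) ==> edge G (f i) (f j)].

(** Taking base-[n] digits is injective from the numbers below [n ^ w] to the maps from ['I_w] to
    ['I_n], and both sets have [n ^ w] elements. *)
Lemma sum_digits n w (F : {ffun 'I_w -> 'I_n} -> nat) (F' : nat -> nat) :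
  (forall (x : 'I_(n ^ w)) (f : {ffun 'I_w -> 'I_n}),
     (forall i : 'I_w, val (f i) = digit n x i) -> F' x = F f) ->
  \sum_(x < n ^ w) F' x = \sum_f F f.
Proof.
move=> H.
have n0 (x : 'I_(n ^ w)) (i : 'I_w) : 0 < n.
  by case: n {F F' H} x => // x; case: x => x; rewrite exp0n //; case: w i => // -[].
pose h (x : 'I_(n ^ w)) : {ffun 'I_w -> 'I_n} :=
  [ffun i : 'I_w => Ordinal (ltn_pmod (x %/ n ^ i) (n0 x i))].
have hE x i : val (h x i) = digit n x i by rewrite ffunE.
have hinj : injective h.
  move=> x y E; apply: val_inj; apply: (digit_inj (ltn_ord x) (ltn_ord y)) => i iw.
  by rewrite -(hE x (Ordinal iw)) -(hE y (Ordinal iw)) E.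
have hbij : bijective h by apply: inj_card_bij => //; rewrite card_ffun !card_ord.
by rewrite (reindex h) /=; [apply: eq_bigr => x _; exact: H|exact: onW_bij].
Qed.

(** A clique tuple is injective because no vertex is adjacent to itself. Sorted by image, each
    [w]-clique is hit by the [w!] injective maps onto it. *)
Lemma card_clique_tuple n (G : graph n) w :
  #|[set f | @clique_tuple n G w f]| = w`! * num_cliques w G.
Proof.
have inj f : @clique_tuple n G w f -> injective f.
  move=> /forallP H i j fij.
  case: (ltngtP i j) => [ij|ij|/val_inj //].
  - by have /forallP/(_ i)/implyP/(_ ij) := H j; rewrite fij edge_irr.
  - by have /forallP/(_ j)/implyP/(_ ij) := H i; rewrite fij edge_irr.
rewrite -sum1_card.
rewrite (partition_big (fun f : {ffun 'I_w -> 'I_n} => f @: [set: 'I_w])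
  (fun V => V \in [set V : {set 'I_n} | (#|V| == w) && is_clique G V])) /=; last first.
  move=> f; rewrite !inE => Hf; rewrite card_imset; last exact: inj.
  rewrite cardsT card_ord eqxx /=.
  apply/forall_inP => _ /imsetP[i _ ->]; apply/forall_inP => _ /imsetP[j _ ->].
  apply/implyP => ne; move/forallP: Hf => Hf.
  case: (ltngtP i j) => [ij|ij|/val_inj E].
  - by have /forallP/(_ i)/implyP/(_ ij) := Hf j.
  - by rewrite edge_sym; have /forallP/(_ j)/implyP/(_ ij) := Hf i.
  - by rewrite E eqxx in ne.
rewrite (eq_bigr (fun=> w`!)); first by rewrite sum_nat_const mulnC.
move=> V; rewrite inE => /andP[/eqP cV clV].
rewrite sum1_card.
have <- : #|[set f in ffun_on V | injectiveb (f : {ffun 'I_w -> 'I_n})]| = w`!.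
  by rewrite (card_inj_ffuns_on 'I_w (mem V)) cV card_ord ffactnn.
apply: eq_card => f; rewrite unfold_in !inE.
apply/andP/andP => [[Hf /eqP <-]|[/forallP fV /injectiveP fi]].
  split; last by apply/injectiveP; exact: inj.
  by apply/forallP => i; apply: imset_f; rewrite inE.
split.
  apply/forallP => j; apply/forallP => i; apply/implyP => ij.
  move/forall_inP: clV => /(_ _ (fV i)) /forall_inP /(_ _ (fV j)) /implyP; apply.
  by apply: contraTneq ij => /fi ->; rewrite ltnn.
rewrite eqEcard card_imset // cardsT card_ord cV leqnn andbT.
by apply/fintype.subsetP => _ /imsetP[i _ ->].
Qed.

Lemma input_edge n (G : graph n) k q (i j : 'I_n) :
  input G k q (3 + (i * n + j)) = edge G i j.
Proof.
rewrite /= ; congr nat_of_bool.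
apply/existsP/idP => [[i' /existsP[j' /andP[/eqP E H]]]|H]; last first.
  by exists i; apply/existsP; exists j; rewrite eqxx.
have n0 : 0 < n by exact: leq_ltn_trans (leq0n i) (ltn_ord i).
have ii : i = i'.
  by apply: val_inj; have := congr1 (divn^~ n) E; rewrite !divnMDl // !divn_small // !addn0.
have jj : j = j'.
  by apply: val_inj; have := congr1 (modn^~ n) E; rewrite !modnMDl !modn_small.
by rewrite ii jj.
Qed.

Lemma tuples_input n (G : graph n) k q w :
  \sum_(x < n ^ w) \prod_(j < w) \prod_(i < j)
    input G k q (3 + (digit n x i * n + digit n x j)) = w`! * num_cliques w G.
Proof.
rewrite -card_clique_tuple -sum1_card [RHS]big_mkcond.
apply: (@sum_digits n w (fun f => if f \in [set f | @clique_tuple n G w f] then 1 else 0)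
  (fun x => \prod_(j < w) \prod_(i < j) input G k q (3 + (digit n x i * n + digit n x j)))).
move=> x f fE; rewrite inE.
have -> : \prod_(j < w) \prod_(i < j) input G k q (3 + (digit n x i * n + digit n x j)) =
  \prod_(j < w) \prod_(i < w | i < j) (edge G (f i) (f j) : nat).
  apply: eq_bigr => j _.
  rewrite (big_ord_widen_cond w (fun=> true)
    (fun i => input G k q (3 + (digit n x i * n + digit n x j)))); last exact: ltnW.
  by apply: eq_bigr => i ij; rewrite -!fE input_edge.
case: ifP => [/forallP H|/negbT].
  apply: big1 => j _; apply: big1 => i ij.
  by have /forallP/(_ i)/implyP/(_ ij) -> := H j.
rewrite negb_forall => /existsP[j]; rewrite negb_forall => /existsP[i].
rewrite negb_imply => /andP[ij /negPf H].
by rewrite (bigD1 j) //= (bigD1 i) //= H mul0n.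
Qed.

(** * The program *)

Definition HSum := HFold OpAdd 0.
Definition HProd := HFold OpMul 1.
Definition HAdd := HBin OpAdd.
Definition HSub := HBin OpSub.
Definition HMul := HBin OpMul.
Definition HDiv := HBin OpDiv.
Definition HMod a b := HSub a (HMul (HDiv a b) b).
Definition HLt a b := HSub (HC 1) (HSub (HAdd a (HC 1)) b).
(* [a'] is the upper argument moved below one more binder. *)
Definition HBinom a' b :=
  HDiv (HProd b (HSub a' (HV 0))) (HProd b (HAdd (HV 0) (HC 1))).

Lemma sem_sum inp rho b e :
  sem inp rho (HSum b e) = \sum_(i < sem inp rho b) sem inp (val i :: rho) e.
Proof.
rewrite /=; elim: (sem inp rho b) => [|N IH]; first by rewrite big_ord0.
by rewrite big_ord_recr /= IH addnC.
Qed.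

Lemma sem_prod inp rho b e :
  sem inp rho (HProd b e) = \prod_(i < sem inp rho b) sem inp (val i :: rho) e.
Proof.
rewrite /=; elim: (sem inp rho b) => [|N IH]; first by rewrite big_ord0.
by rewrite big_ord_recr /= IH mulnC.
Qed.

Lemma sem_mod inp rho a b : sem inp rho (HMod a b) = sem inp rho a %% sem inp rho b.
Proof. by rewrite /= {1}(divn_eq (sem inp rho a) (sem inp rho b)) addKn. Qed.

Lemma sem_lt inp rho a b : sem inp rho (HLt a b) = (sem inp rho a < sem inp rho b).
Proof. by rewrite /=; case: ltnP => h; lia. Qed.

Lemma fact_ord b : \prod_(i < b) (i + 1) = b`!.
Proof.
by elim: b => [|b IH]; rewrite ?big_ord0 // big_ord_recr /= IH factS mulnC addn1.
Qed.

Lemma ffact_ord a b : \prod_(i < b) (a - i) = a ^_ b.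
Proof. by rewrite ffact_prod. Qed.

Lemma sem_binom inp rho a' a b :
  (forall i, sem inp (i :: rho) a' = a) ->
  sem inp rho (HBinom a' b) = 'C(a, sem inp rho b).
Proof.
move=> ha; rewrite /HBinom.
have -> : sem inp rho (HDiv (HProd b (HSub a' (HV 0))) (HProd b (HAdd (HV 0) (HC 1)))) =
  sem inp rho (HProd b (HSub a' (HV 0))) %/ sem inp rho (HProd b (HAdd (HV 0) (HC 1))) by [].
rewrite !sem_prod bin_ffactd -ffact_ord -fact_ord; congr (_ %/ _).
by apply: eq_bigr => i _ /=; rewrite ha.
Qed.

Definition HN := HIn (HC 0).
Definition HK := HIn (HC 1).
Definition HQ := HIn (HC 2).
Definition HD := HSum HK (HLt (HProd (HV 0) HN) (HProd (HC 12) HQ)).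
Definition HDigit i x := HMod (HDiv x (HProd i HN)) HN.
(* As in [HBinom], [w'] is [w] moved below one more binder. *)
Definition HTuples w w' :=
  HSum (HProd w HN) (HProd w' (HProd (HV 0)
    (HIn (HAdd (HC 3) (HAdd (HMul (HDigit (HV 0) (HV 2)) HN) (HDigit (HV 1) (HV 2))))))).
Definition HEdges := HTuples (HC 2) (HC 2).
Definition HPairs := HMul HN (HSub HN (HC 1)).
Definition HKK := HBinom HK (HC 2).
Definition HWW := HBinom (HV 1) (HC 2).
(** Variable 0 is [w] and variable 1 is [j]; under one more binder [w] becomes variable 1. The last
    division, by [w!], turns clique tuples into cliques. *)
Definition HTerm :=
  HMul (HMul (HMul (HMul
    (HBinom (HSub HN (HV 1)) (HSub HK (HV 0)))
    (HBinom (HSub HK (HV 1)) (HSub (HV 1) (HV 0))))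
    (HProd (HSub HKK HWW) HEdges))
    (HProd HWW HPairs))
    (HDiv (HTuples (HV 0) (HV 1)) (HProd (HV 0) (HAdd (HV 0) (HC 1)))).
Definition HParity := HMod (HSub (HV 1) (HV 0)) (HC 2).
(** Registers hold natural numbers, so the negative and positive terms of the alternating sum are
    collected separately; the subtraction in [HNum] then truncates a negative estimate to 0. *)
Definition HNeg := HSum (HAdd HD (HC 1)) (HSum (HAdd (HV 0) (HC 1)) (HMul HParity HTerm)).
Definition HPos :=
  HSum (HAdd HD (HC 1)) (HSum (HAdd (HV 0) (HC 1)) (HMul (HSub (HC 1) HParity) HTerm)).
Definition HNum := HSub HPos HNeg.
Definition HDen := HProd HKK HPairs.

(* For n > 0 this is the least D such that n ^ D >= q ^ 12, capped at k. *)
Definition level (n k q : nat) := \sum_(x < k) (n ^ x < q ^ 12).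

Section Sem.
Variables (n k q : nat) (G : graph n).
Notation inp := (input G k q).

Lemma sem_pow rho b (e : hexp) c : (forall i, sem inp (i :: rho) e = c) ->
  sem inp rho (HProd b e) = c ^ sem inp rho b.
Proof.
move=> h; rewrite sem_prod (eq_bigr (fun=> c)) ?prod_nat_const ?card_ord //.
Qed.

Lemma sem_D rho : sem inp rho HD = level n k q.
Proof.
rewrite sem_sum; apply: eq_bigr => i _.
by rewrite sem_lt (@sem_pow _ _ _ n) // (@sem_pow _ _ _ q).
Qed.

Lemma sem_digit rho i x :
  sem inp rho (HDigit i x) = digit n (sem inp rho x) (sem inp rho i).
Proof.
rewrite sem_mod /digit.
have -> : sem inp rho (HDiv x (HProd i HN)) = sem inp rho x %/ sem inp rho (HProd i HN) by [].
by rewrite (@sem_pow _ _ _ n).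
Qed.

Lemma sem_tuples rho w w' c : sem inp rho w = c -> (forall i, sem inp (i :: rho) w' = c) ->
  sem inp rho (HTuples w w') = c`! * num_cliques c G.
Proof.
move=> hw hw'; rewrite sem_sum (@sem_pow _ _ _ n) // hw -(tuples_input G k q).
apply: eq_bigr => x _; rewrite sem_prod hw'; apply: eq_bigr => j _.
rewrite sem_prod; apply: eq_bigr => i _.
have -> : forall rho a b c d, sem inp rho (HIn (HAdd a (HAdd (HMul b c) d))) =
  inp (sem inp rho a + (sem inp rho b * sem inp rho c + sem inp rho d)) by [].
by rewrite !sem_digit.
Qed.

Lemma sem_edges rho : sem inp rho HEdges = 2 * num_cliques 2 G.
Proof. by rewrite (@sem_tuples _ _ _ 2). Qed.

Lemma sem_kk rho : sem inp rho HKK = 'C(k, 2).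
Proof. exact: sem_binom. Qed.

(** Up to sign, this is the Newton term C(k, j) C(j, w) f(w) scaled by C(n, k) m^C(k, 2), which
    clears all denominators. Here m / M is the edge density, with m = 2 N_2 and M = n (n - 1). *)
Definition term (n k m M j w Nw : nat) :=
  'C(n - w, k - w) * 'C(k - w, j - w) * m ^ ('C(k, 2) - 'C(w, 2)) * M ^ 'C(w, 2) * Nw.

Lemma sem_term w j rho : sem inp (w :: j :: rho) HTerm =
  term n k (2 * num_cliques 2 G) (n * (n - 1)) j w (num_cliques w G).
Proof.
have hm : forall rho a b, sem inp rho (HMul a b) = sem inp rho a * sem inp rho b by [].
have hs : forall rho a b, sem inp rho (HSub a b) = sem inp rho a - sem inp rho b by [].
have ww : sem inp (w :: j :: rho) HWW = 'C(w, 2) by apply: sem_binom.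
rewrite /HTerm !hm /term; congr (_ * _ * _ * _ * _).
- by apply: sem_binom.
- by rewrite (@sem_binom _ _ _ (k - w)).
- rewrite (@sem_pow _ _ _ (2 * num_cliques 2 G)); last by move=> i; exact: sem_edges.
  by rewrite hs ww sem_kk.
- by rewrite (@sem_pow _ _ _ (n * (n - 1))) // ww.
have -> : forall rho a b, sem inp rho (HDiv a b) = sem inp rho a %/ sem inp rho b by [].
rewrite (@sem_tuples _ _ _ w) // sem_prod fact_ord mulKn //.
exact: fact_gt0.
Qed.

Lemma sem_num rho : sem inp rho HNum =
  \sum_(j < (level n k q).+1) \sum_(w < j.+1)
     ~~ odd (j - w) * term n k (2 * num_cliques 2 G) (n * (n - 1)) j w (num_cliques w G) -
  \sum_(j < (level n k q).+1) \sum_(w < j.+1)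
     odd (j - w) * term n k (2 * num_cliques 2 G) (n * (n - 1)) j w (num_cliques w G).
Proof.
have hs : forall rho a b, sem inp rho (HSub a b) = sem inp rho a - sem inp rho b by [].
have ha : forall rho a b, sem inp rho (HAdd a b) = sem inp rho a + sem inp rho b by [].
have hm : forall rho a b, sem inp rho (HMul a b) = sem inp rho a * sem inp rho b by [].
have hp w j : sem inp [:: w, j & rho] HParity = odd (j - w) by rewrite sem_mod hs modn2.
rewrite hs; congr (_ - _); rewrite sem_sum ha sem_D addn1; apply: eq_bigr => j _;
  rewrite sem_sum ha addn1; apply: eq_bigr => w _; rewrite hm sem_term ?hp //.
by rewrite hs hp; case: odd.
Qed.

Lemma sem_den rho : sem inp rho HDen = (n * (n - 1)) ^ 'C(k, 2).
Proof. by rewrite (@sem_pow _ _ _ (n * (n - 1))) // sem_kk. Qed.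

End Sem.

Lemma level_le n k q : level n k q <= k.
Proof.
rewrite /level -[leqRHS](card_ord k) -sum1_card; apply: leq_sum => i _; exact: leq_b1.
Qed.

Lemma levelS n k q : level n k.+1 q = level n k q + (n ^ k < q ^ 12).
Proof. by rewrite /level big_ord_recr. Qed.

(** For positive [n] the powers [n ^ x] are nondecreasing, so the exponents counted by [level] form
    an initial segment. *)
Lemma level_lt n k q w : 0 < n -> w < level n k q -> n ^ w < q ^ 12.
Proof.
move=> n0; elim: k => [|k IH]; first by rewrite /level big_ord0.
rewrite levelS; case: (ltnP (n ^ k)) => h; rewrite ?addn0 // addn1 ltnS => wl.
apply: leq_ltn_trans h; rewrite leq_pexp2l //; exact: leq_trans wl (level_le _ _ _).
Qed.

Lemma level_exact n k q : 0 < n -> level n k q < k -> q ^ 12 <= n ^ level n k q.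
Proof.
move=> n0; elim: k => [|k IH]; first by rewrite ltn0.
rewrite levelS; case: (ltnP (n ^ k)) => h; last first.
  rewrite addn0 => lk; case: (ltngtP (level n k q) k) => [/IH //| |-> //].
  by rewrite ltnNge level_le.
rewrite addn1 ltnS => /IH lq.
have [//|e] := leqP (q ^ 12) (n ^ (level n k q).+1).
have : n ^ level n k q <= n ^ (level n k q).+1 by rewrite leq_pexp2l.
by have := lq; lia.
Qed.

(** Only [n ^ w.-1 < q ^ 12] is known at the top level, which costs a factor [n]; the successor
    covers [w = 0] when [n = 0]. *)
Lemma expn_level n k q w : 0 < q -> w <= level n k q -> n ^ w <= (n * q ^ 12).+1.
Proof.
case: w => [|w] q0 wl; first by rewrite expn0.
case: (posnP n) => [->|n0]; first by rewrite exp0n.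
have h := level_lt n0 wl; rewrite (expnS n w).
by apply: leqW; rewrite leq_mul2l (ltnW h) orbT.
Qed.

(** * Loop lengths and read addresses of the program *)

Section Ok.
Variables (n k q Y : nat) (G : graph n).
Notation inp := (input G k q).
Hypothesis (q0 : 0 < q) (Y12 : 12 <= Y) (kY : k * k + k + 1 <= Y) (nY : n * n <= Y)
  (nwY : forall w, w <= level n k q -> n ^ w <= Y).

Lemma ok_in rho c : c <= 2 -> ok inp Y rho (HIn (HC c)).
Proof. by move=> c3 /=; rewrite /msize /=; split; lia. Qed.

Lemma ok_prod rho b e : ok inp Y rho b -> sem inp rho b <= Y ->
  (forall i, i < sem inp rho b -> ok inp Y (i :: rho) e) -> ok inp Y rho (HProd b e).
Proof. by move=> ? ? ?; split => //; lia. Qed.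

Lemma ok_sum rho b e : ok inp Y rho b -> sem inp rho b <= Y ->
  (forall i, i < sem inp rho b -> ok inp Y (i :: rho) e) -> ok inp Y rho (HSum b e).
Proof. by move=> ? ? ?; split => //; lia. Qed.

Lemma ok_bin rho o a b : ok inp Y rho a -> ok inp Y rho b -> ok inp Y rho (HBin o a b).
Proof. by []. Qed.

Lemma ok_const rho c : c <= 12 -> ok inp Y rho (HC c).
Proof. by move=> c12 /=; lia. Qed.

Lemma ok_D rho : ok inp Y rho HD.
Proof.
apply: ok_sum => [||i ik]; [exact: ok_in|by rewrite /=; lia|].
have ik' : i < k by [].
have o1 : ok inp Y (i :: rho) (HProd (HV 0) HN).
  by apply: ok_prod => //= *; try exact: ok_in; lia.
have o2 : ok inp Y (i :: rho) (HProd (HC 12) HQ).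
  by apply: ok_prod => //= *; try exact: ok_in; lia.
by do !apply: ok_bin => //; exact: ok_const.
Qed.

Lemma ok_digit rho i x : ok inp Y rho i -> ok inp Y rho x -> sem inp rho i <= Y ->
  ok inp Y rho (HDigit i x).
Proof.
move=> oi ox iY.
have o1 : ok inp Y rho (HDiv x (HProd i HN)).
  by apply: ok_bin => //; apply: ok_prod => // *; exact: ok_in.
by do !apply: ok_bin => //; exact: ok_in.
Qed.

Lemma ok_tuples rho w w' c : ok inp Y rho w -> sem inp rho w = c ->
  (forall x, ok inp Y (x :: rho) w') -> (forall x, sem inp (x :: rho) w' = c) ->
  c <= Y -> n ^ c <= Y -> ok inp Y rho (HTuples w w').
Proof.
move=> ow sw ow' sw' cY ncY; apply: ok_sum.
- by apply: ok_prod; rewrite ?sw // => *; exact: ok_in.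
- by rewrite (@sem_pow _ _ _ _ _ _ _ n) // sw.
rewrite (@sem_pow _ _ _ _ _ _ _ n) // sw => x xn.
apply: ok_prod; rewrite ?sw' // => j jc.
apply: ok_prod => [//||i ij]; first by rewrite /=; lia.
have ij' : i < j by [].
have n0 : 0 < n by case: n xn => // h; rewrite exp0n // in h; case: (c) jc.
have o1 : ok inp Y [:: i, j, x & rho] (HDigit (HV 0) (HV 2)).
  by apply: ok_digit => //=; lia.
have o2 : ok inp Y [:: i, j, x & rho] (HDigit (HV 1) (HV 2)).
  by apply: ok_digit => //=; lia.
split.
  by do !apply: ok_bin => //; try exact: ok_const; exact: ok_in.
have -> : forall rho a b c d, sem inp rho (HAdd a (HAdd (HMul b c) d)) =
  sem inp rho a + (sem inp rho b * sem inp rho c + sem inp rho d) by [].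
rewrite !sem_digit [sem _ _ HN]/= [sem _ _ (HC _)]/= /msize /=.
have d1 : digit n x i < n by exact: ltn_pmod.
have d2 : digit n x j < n by exact: ltn_pmod.
by nia.
Qed.

Lemma ok_binom rho a' b : (forall i, ok inp Y (i :: rho) a') -> ok inp Y rho b ->
  sem inp rho b <= Y -> ok inp Y rho (HBinom a' b).
Proof.
move=> oa ob bY; apply: ok_bin; apply: ok_prod => // i _; apply: ok_bin => //.
exact: ok_const.
Qed.

Lemma ok_edges rho : ok inp Y rho HEdges.
Proof.
by apply: (@ok_tuples _ _ _ 2) => // *; try exact: ok_const; rewrite ?expnS ?expn0 ?muln1; lia.
Qed.

Lemma ok_pairs rho : ok inp Y rho HPairs.
Proof. by do !apply: ok_bin => //; try exact: ok_const; exact: ok_in. Qed.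

Lemma ok_kk rho : ok inp Y rho HKK.
Proof.
apply: ok_binom => [i||]; [exact: ok_in|exact: ok_const|by rewrite /=; lia].
Qed.

Lemma bin2_le w : w <= k -> 'C(w, 2) <= Y.
Proof. by move=> wk; rewrite bin2 -divn2; have := leq_div (w * w.-1) 2; nia. Qed.

Lemma ok_term w j : w <= j -> j <= level n k q -> ok inp Y [:: w; j] HTerm.
Proof.
move=> wj jl; have lk := level_le n k q.
have hs : forall rho a b, sem inp rho (HSub a b) = sem inp rho a - sem inp rho b by [].
have oN rho : ok inp Y rho HN by exact: ok_in.
have oK rho : ok inp Y rho HK by exact: ok_in.
have ow : ok inp Y [:: w; j] HWW by apply: ok_binom => //; [exact: ok_const|rewrite /=; lia].
have sw : sem inp [:: w; j] HWW = 'C(w, 2) by apply: sem_binom.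
have ok2 := ok_kk [:: w; j].
apply: ok_bin; first apply: ok_bin; first apply: ok_bin; first apply: ok_bin.
- by apply: ok_binom => //; rewrite /=; lia.
- by apply: ok_binom => //; rewrite /=; lia.
- apply: ok_prod => // [|i _]; last exact: ok_edges.
  by rewrite hs sem_kk; have := @bin2_le k (leqnn k); lia.
- apply: ok_prod => // [|i _]; last exact: ok_pairs.
  by rewrite sw; apply: bin2_le; lia.
apply: ok_bin.
  by apply: (@ok_tuples _ _ _ w) => //; [lia|apply: nwY; lia].
apply: ok_prod => // [|i _]; first by rewrite /=; lia.
by apply: ok_bin => //; exact: ok_const.
Qed.

Lemma ok_num : ok inp Y [::] HNum.
Proof.
have op w j : ok inp Y [:: w; j] HParity by do !apply: ok_bin => //; exact: ok_const.
have ha : forall rho a b, sem inp rho (HAdd a b) = sem inp rho a + sem inp rho b by [].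
have lk := level_le n k q.
have o1 rho : ok inp Y rho (HAdd HD (HC 1)) by apply: ok_bin; [exact: ok_D|exact: ok_const].
have s1 rho : sem inp rho (HAdd HD (HC 1)) = level n k q + 1 by rewrite ha sem_D.
have o2 j : ok inp Y [:: j] (HAdd (HV 0) (HC 1)) by apply: ok_bin => //; exact: ok_const.
have s2 j : sem inp [:: j] (HAdd (HV 0) (HC 1)) = j.+1 by rewrite ha /= addn1.
have os e : (forall w j, ok inp Y [:: w; j] e) ->
    ok inp Y [::] (HSum (HAdd HD (HC 1)) (HSum (HAdd (HV 0) (HC 1)) (HMul e HTerm))).
  move=> oe; apply: ok_sum => //; rewrite s1; first lia.
  move=> j jl; apply: ok_sum => //; rewrite s2; first lia.
  by move=> w wj; apply: ok_bin => //; apply: ok_term; lia.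
by apply: ok_bin; apply: os => // w j; apply: ok_bin => //; exact: ok_const.
Qed.

Lemma ok_den : ok inp Y [::] HDen.
Proof.
apply: ok_prod; [exact: ok_kk|rewrite sem_kk; exact: bin2_le|].
by move=> i _; exact: ok_pairs.
Qed.

End Ok.

Definition cliques_program : cmd :=
  Seq (compile [::] 0 HNum) (Seq (compile [::] 1 HDen)
    (Seq (Assign (Cst 1) (Get (reg 1))) (Assign (Cst 0) (Get (reg 0))))).

Lemma input_le n k q (G : graph n) Y a : 0 < Y -> n <= Y -> k <= Y -> q <= Y ->
  input G k q a <= Y.
Proof.
by move=> Y0 nY kY qY; case: a => [|[|[|a]]] //=; apply: leq_trans (leq_b1 _) Y0.
Qed.

(** A time budget uses one constant both as factor and as exponent, hence the sum
    [C ^ h + 13 * h]. *)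
Lemma expn_budget C X h : 0 < C -> 0 < X ->
  (C * X ^ 13) ^ h <= (C ^ h + 13 * h) * X ^ (C ^ h + 13 * h).
Proof.
move=> C0 X0; rewrite expnMn -expnM leq_mul //; first by rewrite leq_addr.
by rewrite leq_pexp2l // leq_addl.
Qed.

Lemma cliques_programP K : exists c, forall n k q (G : graph n) (w : seq bool),
  k <= K * n.+1 -> 0 < q -> size w = c * (n + q) ^ c ->
  let s := exec cliques_program (input G k q) w in
  [/\ todo s = [::], time s <= c * (n + q) ^ c,
      memory s 0 = sem (input G k q) [::] HNum & memory s 1 = sem (input G k q) [::] HDen].
Proof.
set r := nregs HNum + nregs HDen.
(* The height is kept abstract so that powers with this exponent are never unfolded. *)
have [h hE] : exists h, h = height HNum + height HDen + 3 by eexists.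
pose C := 200 + K * K + K + r.
exists (C ^ h + 13 * h) => n k q G w kK q0 sw.
set T := (C ^ h + 13 * h) * _ in sw *.
(* The exponent 13 comes from the enumeration bound [n * q ^ 12 <= X ^ 13]. The constant [C] leaves
   room for fixed constants, for [k * k + k] with [k <= K * X], and for the [r] registers. *)
pose X := n + q; pose Y := C * X ^ 13.
have X0 : 0 < X by rewrite /X; lia.
have XX i : i <= 13 -> X ^ i <= X ^ 13 by move=> ?; rewrite leq_pexp2l.
have kX : k <= K * X by apply: leq_trans kK _; rewrite leq_mul2l /X; apply/orP; right; lia.
have x0 := XX 0 isT; rewrite expn0 in x0.
have x1 := XX 1 isT; rewrite expn1 in x1.
have x2 := XX 2 isT; rewrite expnS expn1 in x2.
have kk : k * k + k <= (K * K + K) * X ^ 13.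
  have : k * k <= (K * K) * (X * X) by rewrite mulnACA leq_mul.
  have : (K * K) * (X * X) <= (K * K) * X ^ 13 by rewrite leq_mul2l x2 orbT.
  have : K * X <= K * X ^ 13 by rewrite leq_mul2l x1 orbT.
  by rewrite mulnDl; lia.
have YE : Y = 200 * X ^ 13 + (K * K + K) * X ^ 13 + r * X ^ 13.
  by rewrite /Y /C !mulnDl; lia.
have rX : r <= r * X ^ 13 by rewrite leq_pmulr.
have nn : n * n <= X * X by rewrite leq_mul // /X; lia.
have nq : n * q ^ 12 <= X ^ 13.
  by rewrite (expnS X 12) leq_mul ?leq_exp2r // /X; lia.
have nX : n <= X by rewrite /X; lia.
have qX : q <= X by rewrite /X; lia.
have nw v : v <= level n k q -> n ^ v <= Y.
  by move=> vl; apply: leq_trans (expn_level q0 vl) _; lia.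
have Y12 : 12 <= Y by lia.
have kY : k * k + k + 1 <= Y by lia.
have nY : n * n <= Y by lia.
have on : ok (input G k q) Y [::] HNum by apply: ok_num.
have od : ok (input G k q) Y [::] HDen by apply: ok_den.
have rY : msize (input G k q) + nregs HNum + nregs HDen + 2 <= Y.
  by rewrite /msize [input _ _ _ 0]/= -addnA addnAC -addnA -/r; lia.
have iY a : input G k q a <= Y by apply: input_le; lia.
have [m' [m0 m1] Hr] := @runs_compile _ Y ltac:(lia) iY ltac:(lia) _ _ on od rY.
rewrite -hE in Hr.
have YT : Y ^ h <= T by apply: expn_budget => //; rewrite /C; lia.
have Tw : Y ^ h <= size w by rewrite sw.
have [t tT ->] := exec_runs Hr Tw.
by split => //=; exact: leq_trans tT YT.
Qed.

Local Open Scope ring_scope.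

(** * Expansion of the clique counts *)

(** Complementation turns supersets of [A] into subsets of its complement. Written with [#|T| - w],
    the binomial vanishes by itself when [w < #|A|]. *)
Lemma card_supersets (T : finType) (A : {set T}) w : (w <= #|T|)%N ->
  #|[set W : {set T} | (#|W| == w) && (A \subset W)]| = 'C(#|T| - #|A|, #|T| - w).
Proof.
move=> wT; have <- : #|~: A| = (#|T| - #|A|)%N by rewrite cardsCs finset.setCK.
rewrite -cards_draws -(card_imset _ (@finset.setC_inj T)).
apply: eq_card => B; rewrite inE; apply/imsetP/andP.
  move=> [W]; rewrite inE => /andP[/eqP cW AW] ->.
  by rewrite finset.setCS AW cardsCs finset.setCK cW.
move=> [BA /eqP cB]; exists (~: B); last by rewrite finset.setCK.
rewrite inE -(finset.setCK A) finset.setCS BA cardsCs finset.setCK cB andbT.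
by apply/eqP; rewrite subKn.
Qed.

(** Both sides count pairs of a [u]-set inside a [w]-set of an [N]-set. *)
Lemma bin_supersets N w u : (w <= N)%N ->
  ('C(N - u, N - w) * 'C(N, u) = 'C(N, w) * 'C(w, u))%N.
Proof.
move=> wN; have [wu|uw] := ltnP w u.
  rewrite (bin_small wu) muln0.
  have [uN|Nu] := leqP u N; last by rewrite (bin_small Nu) muln0.
  by rewrite bin_small // ltn_sub2l //; apply: leq_trans uN.
have uN := leq_trans uw wN.
apply/eqP; rewrite -(eqn_pmul2r (fact_gt0 u)) -(eqn_pmul2r (fact_gt0 (N - w)))
  -(eqn_pmul2r (fact_gt0 (w - u))); apply/eqP.
have h1 := bin_fact uN; have h2 := bin_fact wN; have h3 := bin_fact uw.
have h4 := @bin_fact (N - u) (N - w) (leq_sub2l _ uw).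
have E : (N - u - (N - w) = w - u)%N by lia.
rewrite E in h4.
transitivity N`!; [rewrite -h1 -h4|rewrite -h2 -h3]; ring.
Qed.

(** An object covering [u] points lies in C(N - u, N - w) sets of size [w]. This yields expansions
    in the basis C(w, u), both for clique counts and for [tilt]. *)
Lemma sum_supersets (R : realType) (T X : finType) (P : pred X) (c : X -> {set T})
    (om : X -> R) w : (w <= #|T|)%N ->
  \sum_(W : {set T} | #|W| == w) \sum_(x | P x && (c x \subset W)) om x =
  'C(#|T|, w)%:R * \sum_(u < #|T|.+1) 'C(w, u)%:R *
     ((\sum_(x | P x && (#|c x| == u)) om x) / 'C(#|T|, u)%:R).
Proof.
move=> wT.
rewrite (exchange_big_dep P) /=; last by move=> W x _ /andP[].
rewrite mulr_sumr.
under [RHS]eq_bigr => u _ do rewrite mulr_suml !mulr_sumr.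
rewrite (exchange_big_dep P) /=; last by move=> u x _ /andP[].
apply: eq_bigr => x Px; rewrite Px /=.
have cT : (#|c x| < #|T|.+1)%N by rewrite ltnS max_card.
rewrite [RHS](bigD1 (Ordinal cT)) //= [X in _ = _ + X]big1 ?addr0; last first.
  by move=> u /andP[/eqP E /eqP[]]; apply: val_inj; rewrite /= -E.
rewrite sumr_const -cardsE card_supersets //.
have N0 : 'C(#|T|, #|c x|)%:R != 0 :> R by rewrite pnatr_eq0 -lt0n bin_gt0 max_card.
apply: (mulIf N0); rewrite -[om x *+ _]mulr_natr -!mulrA mulVf // mulr1.
by rewrite -natrM bin_supersets // natrM mulrCA [om x * _]mulrC mulrCA.
Qed.

Lemma prod_1D (R : realType) (I : finType) (A : {set I}) (y : I -> R) :
  \prod_(e in A) (1 + y e) = \sum_(S : {set I} | S \subset A) \prod_(e in S) y e.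
Proof.
have -> : \prod_(e in A) (1 + y e) = \prod_e ((if e \in A then y e else 0) + 1).
  by rewrite big_mkcond; apply: eq_bigr => e _; case: ifP; rewrite ?add0r // addrC.
rewrite bigA_distr /= [RHS]big_mkcond; apply: eq_bigr => S _.
case: ifPn => [/fintype.subsetP SA|/subsetPn[e eS eA]].
  rewrite [RHS]big_mkcond; apply: eq_bigr => e _.
  by case: ifP => // /SA ->.
by rewrite (bigD1 e) //= eS (negbTE eA) mul0r.
Qed.

Definition pairs_in n (W : {set 'I_n}) : {set {set 'I_n}} :=
  [set e : {set 'I_n} | e \subset W & #|e| == 2].

Lemma card_pairs_in n (W : {set 'I_n}) : #|pairs_in W| = 'C(#|W|, 2).
Proof. exact: cards_draws. Qed.

Lemma sub_pairs_in n (W : {set 'I_n}) (S : {set {set 'I_n}}) :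
  (S \subset pairs_in W) = (S \subset pairs n) && (finset.cover S \subset W).
Proof.
apply/fintype.subsetP/andP => [H|[/fintype.subsetP H /bigcupsP H'] e eS].
  split; first by apply/fintype.subsetP => e /H; rewrite !inE => /andP[].
  by apply/bigcupsP => e /H; rewrite inE => /andP[].
by rewrite inE (H' _ eS); have := H _ eS; rewrite inE.
Qed.

Lemma is_cliqueE n (G : graph n) W : is_clique G W = (pairs_in W \subset val G).
Proof.
apply/idP/fintype.subsetP => [/forall_inP H e|H].
  rewrite inE => /andP[eW /cards2P[i [j [ij eE]]]].
  rewrite eE finset.subUset !finset.sub1set in eW; case/andP: eW => iW jW.
  by rewrite eE; move/forall_inP/(_ j jW)/implyP: (H i iW); apply.
apply/forall_inP => i iW; apply/forall_inP => j jW; apply/implyP => ij.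
by apply: H; rewrite inE finset.subUset !finset.sub1set iW jW cards2 ij.
Qed.

Definition centered (R : realType) (p : R) n (G : graph n) (e : {set 'I_n}) : R :=
  (e \in val G)%:R / p - 1.

Definition cover_sum (R : realType) (p : R) n (G : graph n) (u : nat) : R :=
  \sum_(S : {set {set 'I_n}} | (S \subset pairs n) && (#|finset.cover S| == u))
    \prod_(e in S) centered p G e.

Definition alpha (R : realType) (p : R) n (G : graph n) (u : nat) : R :=
  cover_sum p G u / 'C(n, u)%:R.

Lemma is_clique_prod (R : realType) (p : R) n (G : graph n) W : p != 0 ->
  (is_clique G W)%:R = p ^+ 'C(#|W|, 2) * \prod_(e in pairs_in W) (1 + centered p G e).
Proof.
move=> p0; have -> : p ^+ 'C(#|W|, 2) = \prod_(e in pairs_in W) p.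
  by rewrite prodr_const card_pairs_in.
rewrite -big_split /=.
rewrite [RHS](eq_bigr (fun e : {set 'I_n} => (e \in val G)%:R : R)); last first.
  by move=> e _; rewrite /centered addrC subrK mulrCA divff // mulr1.
rewrite is_cliqueE; case: (boolP (_ \subset _)) => [/fintype.subsetP H|/subsetPn[e eW eG]].
  by rewrite big1 // => e /H ->.
by rewrite (bigD1 e) //= (negbTE eG) mul0r.
Qed.

(** The indicator of a clique on [W] is p^C(w, 2) times the product of 1 + y_e over the pairs in
    [W]. Expanding gives a sum over edge sets whose cover lies in [W], to which [sum_supersets]
    applies. *)
Lemma num_cliques_alpha (R : realType) (p : R) n (G : graph n) w : p != 0 -> (w <= n)%N ->
  (num_cliques w G)%:R =
  'C(n, w)%:R * p ^+ 'C(w, 2) * \sum_(u < n.+1) 'C(w, u)%:R * alpha p G u.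
Proof.
move=> p0 wn.
have -> : (num_cliques w G)%:R = \sum_(W : {set 'I_n} | #|W| == w) (is_clique G W)%:R :> R.
  rewrite /num_cliques -sum1_card natr_sum big_mkcond [RHS]big_mkcond.
  by apply: eq_bigr => W _; rewrite inE; case: (_ == _) => //=; case: is_clique.
transitivity (\sum_(W : {set 'I_n} | #|W| == w) p ^+ 'C(w, 2) * \sum_(S : {set {set 'I_n}} |
    (S \subset pairs n) && (finset.cover S \subset W)) \prod_(e in S) centered p G e).
  apply: eq_bigr => W /eqP cW.
  rewrite (is_clique_prod _ _ p0) cW prod_1D; congr (_ * _).
  by apply: eq_bigl => S; rewrite sub_pairs_in.
rewrite -mulr_sumr sum_supersets ?card_ord // mulrCA mulrA.
by congr (_ * _ * _); rewrite mulrC.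
Qed.

Lemma cover_sum0 (R : realType) (p : R) n (G : graph n) : cover_sum p G 0 = 1.
Proof.
rewrite /cover_sum (big_pred1 finset.set0) ?big_set0 // => S.
apply/andP/eqP => [[/fintype.subsetP Sp]|->]; last first.
  by rewrite finset.sub0set /finset.cover big_set0 cards0.
rewrite cards_eq0 => /eqP cS; apply/eqP; rewrite -finset.subset0; apply/fintype.subsetP => e eS.
have : e \subset finset.cover S by exact: finset.bigcup_sup.
rewrite cS finset.subset0 => /eqP e0; have := Sp _ eS; by rewrite inE e0 cards0.
Qed.

(** A nonempty edge set covers at least two vertices. Consequently the density deviates from [p]
    through [alpha] at 2 alone. *)
Lemma cover_sum1 (R : realType) (p : R) n (G : graph n) : cover_sum p G 1 = 0.
Proof.
rewrite /cover_sum big_pred0 // => S; apply/negP => /andP[/fintype.subsetP Sp c1].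
have [S0|[e eS]] := set_0Vmem S.
  by move: c1; rewrite S0 /finset.cover big_set0 cards0.
have : e \subset finset.cover S by exact: finset.bigcup_sup.
move/subset_leq_card; rewrite (eqP c1); have := Sp _ eS; by rewrite inE => /eqP ->.
Qed.

(** * Newton interpolation *)

(** Compare the coefficients of X^u in X^j = (-1 + (X + 1))^j. *)
Lemma alternating_bin (R : comNzRingType) j u : (u <= j)%N ->
  \sum_(w < j.+1) (-1) ^+ (j - w) * 'C(j, w)%:R * 'C(w, u)%:R = (u == j)%:R :> R.
Proof.
move=> uj.
have E w : (('X + 1 : {poly R}) ^+ w)`_u = 'C(w, u)%:R.
  rewrite addrC exprDn coef_sum.
  have [uw|wu] := ltnP u w.+1; last first.
    rewrite bin_small // big1 // => i _.
    rewrite expr1n mul1r coefMn coefXn.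
    by case: eqP => [e|_]; rewrite ?mul0rn //; have := ltn_ord i; lia.
  rewrite (bigD1 (Ordinal uw)) //= big1 ?addr0.
    by rewrite expr1n mul1r coefMn coefXn eqxx.
  move=> i /eqP ne; rewrite expr1n mul1r coefMn coefXn.
  by case: eqP => [e|_]; rewrite ?mul0rn //; case: ne; apply: val_inj.
have -> : (u == j)%:R = ('X^j : {poly R})`_u by rewrite coefXn.
have -> : ('X^j : {poly R}) = (-1 + ('X + 1)) ^+ j by rewrite addrCA addNr addr0.
rewrite exprDn coef_sum; apply: eq_bigr => w _.
rewrite coefMn -[in RHS]polyC1 -polyCN -polyC_exp coefCM polyC1 E.
by rewrite -mulr_natr; ring.
Qed.

(** The [j]-th finite difference at 0 extracts the coefficient of C(w, j). *)
Lemma newton (R : comNzRingType) k (f g : nat -> R) j :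
  (forall w, (w <= k)%N -> f w = \sum_(u < k.+1) 'C(w, u)%:R * g u) -> (j <= k)%N ->
  \sum_(w < j.+1) (-1) ^+ (j - w) * 'C(j, w)%:R * f w = g j.
Proof.
move=> hf jk.
transitivity (\sum_(u < k.+1) g u * \sum_(w < j.+1) (-1) ^+ (j - w) * 'C(j, w)%:R * 'C(w, u)%:R).
  under [RHS]eq_bigr => u _ do rewrite mulr_sumr.
  rewrite exchange_big; apply: eq_bigr => w _.
  rewrite hf; last by have := ltn_ord w; lia.
  rewrite mulr_sumr; apply: eq_bigr => u _; ring.
have jk' : (j < k.+1)%N by [].
rewrite (bigD1 (Ordinal jk')) //= alternating_bin // eqxx mulr1 big1 ?addr0 // => u ne.
have [uj|ju] := leqP u j.
  rewrite alternating_bin //; case: eqP => [e|_]; last by rewrite mulr0.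
  by case/eqP: ne; apply: val_inj.
rewrite big1 ?mulr0 // => w _; rewrite (@bin_small w u) ?mulr0 //.
by have := ltn_ord w; lia.
Qed.

(* The coefficient of C(w, u) in (1 + d)^C(w, 2) C(w, i) for w <= k: both factors
   count subsets of a w-set, which are sorted by the number of vertices covered. *)
Definition tilt (R : realType) (d : R) k i u : R :=
  (\sum_(x : {set {set 'I_k}} * {set 'I_k} |
      ((x.1 \subset pairs k) && (#|x.2| == i)) && (#|finset.cover x.1 :|: x.2| == u))
    d ^+ #|x.1|) / 'C(k, u)%:R.

Lemma sum_subset_exp (R : realType) (T : finType) (A : {set T}) (d : R) :
  \sum_(S : {set T} | S \subset A) d ^+ #|S| = (1 + d) ^+ #|A|.
Proof.
rewrite -prodr_const prod_1D; apply: eq_bigr => S _; by rewrite prodr_const.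
Qed.

(** Summing over all [w]-subsets of a [k]-set the number of pairs inside, weighted by powers of [d],
    gives the same amount for each subset; the factor C(k, w) then cancels. *)
Lemma tiltE (R : realType) (d : R) k i w : (w <= k)%N ->
  (1 + d) ^+ 'C(w, 2) * 'C(w, i)%:R = \sum_(u < k.+1) 'C(w, u)%:R * tilt d k i u.
Proof.
move=> wk.
have := @sum_supersets R 'I_k {: {set {set 'I_k}} * {set 'I_k}}
  (fun x => (x.1 \subset pairs k) && (#|x.2| == i)) (fun x => finset.cover x.1 :|: x.2)
  (fun x => d ^+ #|x.1|) w.
rewrite card_ord => /(_ wk).
have -> : \sum_(W : {set 'I_k} | #|W| == w) \sum_(x : {set {set 'I_k}} * {set 'I_k} |
    ((x.1 \subset pairs k) && (#|x.2| == i)) && (finset.cover x.1 :|: x.2 \subset W))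
    d ^+ #|x.1| = \sum_(W : {set 'I_k} | #|W| == w) (1 + d) ^+ 'C(w, 2) * 'C(w, i)%:R.
  apply: eq_bigr => W /eqP cW.
  rewrite -cW -(card_pairs_in W) -sum_subset_exp -cards_draws -sum1_card natr_sum mulr_suml.
  under [RHS]eq_bigr => S _ do rewrite mulr_sumr.
  rewrite pair_big_dep /=; apply: eq_big => [[S I]|[S I] _] /=; last by rewrite mulr1.
  rewrite finset.subUset sub_pairs_in !inE.
  by case: (S \subset _); case: (finset.cover S \subset W); case: (I \subset W); case: (#|I| == i).
have -> : \sum_(W : {set 'I_k} | #|W| == w) (1 + d) ^+ 'C(w, 2) * 'C(w, i)%:R =
    'C(k, w)%:R * ((1 + d) ^+ 'C(w, 2) * 'C(w, i)%:R).
  rewrite sumr_const -[X in X%:R * _](_ : #|[set W : {set 'I_k} | #|W| == w]| = _).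
    by rewrite cardsE mulr_natl.
  by rewrite card_draws card_ord.
apply: mulfI; by rewrite pnatr_eq0 -lt0n bin_gt0.
Qed.

(** A pair (S, I) covers at most 2 |S| + i points. If it covers more than [D], then b^(2 |S|) <=
    b^(D + 1 - i), so |d|^|S| is at most b^(D + 1 - i) (|d| / b^2)^|S|; afterwards all pairs may be
    summed. *)
Lemma tilt_tail (R : realType) (d b : R) k i D : 0 < b -> b <= 1 ->
  \sum_(u < k.+1 | (D < u)%N) 'C(k, u)%:R * `|tilt d k i u| <=
  'C(k, i)%:R * b ^+ (D.+1 - i) * (1 + `|d| / b ^+ 2) ^+ 'C(k, 2).
Proof.
move=> b0 b1.
set r := `|d| / b ^+ 2.
have r0 : 0 <= r by rewrite /r divr_ge0 // exprn_ge0 // ltW.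
apply: (@le_trans _ _ (\sum_(u < k.+1 | (D < u)%N)
  \sum_(x : {set {set 'I_k}} * {set 'I_k} |
      ((x.1 \subset pairs k) && (#|x.2| == i)) && (#|finset.cover x.1 :|: x.2| == u))
    b ^+ (D.+1 - i) * r ^+ #|x.1|)).
  apply: ler_sum => u Du.
  have uk : ('C(k, u)%:R != 0 :> R) by rewrite pnatr_eq0 -lt0n bin_gt0 -ltnS.
  rewrite /tilt normrM normfV (ger0_norm (ler0n _ _)) mulrCA divff // mulr1.
  apply: le_trans (ler_norm_sum _ _ _) _; apply: ler_sum => -[S I] /=.
  move=> /andP[/andP[/fintype.subsetP Sp /eqP cI] /eqP cu].
  have cS : (#|finset.cover S| <= 2 * #|S|)%N.
    apply: leq_trans (leq_card_cover S) _.
    rewrite (eq_bigr (fun=> 2%N)) ?sum_nat_const 1?mulnC // => e /Sp.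
    by rewrite inE => /eqP.
  have cSI : (#|finset.cover S :|: I| <= 2 * #|S| + i)%N.
    by apply: leq_trans (leq_card_setU _ _) _; rewrite cI leq_add2r.
  have -> : r ^+ #|S| = `|d| ^+ #|S| * (b ^+ (2 * #|S|))^-1.
    by rewrite /r expr_div_n -exprM.
  rewrite normrX mulrCA ler_peMr ?exprn_ge0 // ler_pdivlMr ?exprn_gt0 // mul1r.
  apply: ler_wiXn2l => //; [exact: ltW|]; by rewrite leq_subLR addnC; apply: leq_trans Du _; rewrite -cu.
rewrite (exchange_big_dep (fun x : {set {set 'I_k}} * {set 'I_k} =>
   (x.1 \subset pairs k) && (#|x.2| == i))) /=; last by move=> u x _ /andP[].
apply: (@le_trans _ _ (\sum_(x : {set {set 'I_k}} * {set 'I_k} |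
   (x.1 \subset pairs k) && (#|x.2| == i)) b ^+ (D.+1 - i) * r ^+ #|x.1|)).
  apply: ler_sum => x Px; rewrite Px /=.
  have t0 : 0 <= b ^+ (D.+1 - i) * r ^+ #|x.1| by rewrite mulr_ge0 ?exprn_ge0 // ltW.
  have cx : (#|finset.cover x.1 :|: x.2| < k.+1)%N.
    by rewrite ltnS -[leqRHS](card_ord k) max_card.
  rewrite big_mkcond (bigD1 (Ordinal cx)) //= big1 ?addr0; first by case: ifP.
  move=> u ne; case: ifP => // /andP[_ /eqP e]; case/eqP: ne; apply: val_inj; by rewrite /= e.
rewrite -mulr_sumr [_%:R * _]mulrC -mulrA ler_wpM2l ?exprn_ge0 // ?(ltW b0) //.
have ck : #|pairs k| = 'C(k, 2) by rewrite card_draws card_ord.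
have -> : 'C(k, i)%:R = \sum_(I : {set 'I_k} | #|I| == i) 1 :> R.
  by rewrite sumr_const -cardsE card_draws card_ord.
rewrite -ck -sum_subset_exp mulrC mulr_suml.
under [leRHS]eq_bigr => S _ do rewrite mulr_sumr.
rewrite pair_big_dep /= le_eqVlt; apply/orP; left; apply/eqP.
by apply: eq_big => [[S I]|[S I] _] /=; rewrite ?mulr1.
Qed.

(** Both sides count chains of sets of sizes w, j, k in an n-set, chosen from the inside or from the
    outside. *)
Lemma bin_chain n k j w : (w <= j)%N -> (j <= k)%N -> (k <= n)%N ->
  ('C(n - w, k - w) * 'C(k - w, j - w) * 'C(n, w) = 'C(n, k) * 'C(k, j) * 'C(j, w))%N.
Proof.
move=> wj jk kn.
have h1 := bin_fact (leq_trans wj (leq_trans jk kn)).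
have h2 := @bin_fact (n - w) (k - w) (leq_sub2r _ kn).
have h3 := @bin_fact (k - w) (j - w) (leq_sub2r _ jk).
have h4 := bin_fact kn; have h5 := bin_fact jk; have h6 := bin_fact wj.
rewrite (_ : n - w - (k - w) = n - k)%N in h2; last by lia.
rewrite (_ : k - w - (j - w) = k - j)%N in h3; last by lia.
apply/eqP; rewrite -(eqn_pmul2r (fact_gt0 w)) -(eqn_pmul2r (fact_gt0 (n - k)))
  -(eqn_pmul2r (fact_gt0 (k - j))) -(eqn_pmul2r (fact_gt0 (j - w))); apply/eqP.
transitivity n`!; [rewrite -h1 -h2 -h3|rewrite -h4 -h5 -h6]; ring.
Qed.

(** * Interpolation error for deterministic coefficients *)

Section InterpolationError.
Variables (R : realType) (p b : R) (n k : nat) (a : nat -> R) (Nc : nat -> nat).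
Hypotheses (p0 : 0 < p) (b0 : 0 < b) (b1 : b <= 2^-1) (k2 : (2 <= k)%N) (kn : (k <= n)%N)
  (a0 : a 0 = 1) (a1 : a 1 = 0)
  (ab : forall i, (0 < i <= k)%N -> 'C(k, i)%:R * `|a i| <= b ^+ i)
  (NcE : forall w, (w <= k)%N ->
    (Nc w)%:R = 'C(n, w)%:R * p ^+ 'C(w, 2) * \sum_(i < k.+1) 'C(w, i)%:R * a i)
  (bk : expR 2 * k.+1%:R * b <= 8^-1).

Let m := (2 * Nc 2)%N.
Let M := (n * (n - 1))%N.
Let q : R := m%:R / M%:R.
Let d := (1 + a 2)^-1 - 1.
Let g u := \sum_(i < k.+1) a i * tilt d k i u.
Let f w := (1 + d) ^+ 'C(w, 2) * \sum_(i < k.+1) 'C(w, i)%:R * a i.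

Let M0 : M%:R != 0 :> R.
Proof. by rewrite pnatr_eq0 /M muln_eq0; lia. Qed.

Let a2b : 'C(k, 2)%:R * `|a 2| <= b ^+ 2.
Proof. by apply: ab; rewrite k2. Qed.

Let C1 : 1 <= 'C(k, 2)%:R :> R.
Proof. by rewrite ler1n bin_gt0. Qed.

Let a2small : `|a 2| <= 2^-1.
Proof.
apply: (@le_trans _ _ ('C(k, 2)%:R * `|a 2|)); first by rewrite ler_peMl.
apply: (le_trans a2b); rewrite expr2; have := b0; have := b1; nra.
Qed.

Let a2pos : 2^-1 <= 1 + a 2.
Proof. by move: a2small; rewrite ler_norml; lra. Qed.

(** For [w = 2] the coefficients C(2, i) vanish beyond 2, and [a 1 = 0]. *)
Let qE : q = p * (1 + a 2).
Proof.
have E : (Nc 2)%:R = 'C(n, 2)%:R * p * (1 + a 2).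
  rewrite NcE // bin2 expr1; congr (_ * _).
  rewrite (bigD1 ord0) //= bin0 a0 mulr1.
  have i1 : (1 < k.+1)%N := leqW k2.
  have i2 : (2 < k.+1)%N by [].
  rewrite (bigD1 (Ordinal i1)) //= a1 mulr0 add0r (bigD1 (Ordinal i2)) //= binn mul1r.
  rewrite big1 ?addr0 // => i /andP[/andP[ne0 ne1] ne2].
  case: i ne0 ne1 ne2 => [[|[|[|i]]] ik] //= _ _ _.
  by rewrite bin_small // mul0r.
have CM : M = (2 * 'C(n, 2))%N.
  by rewrite -(mul_bin_diag n 1) bin1 /M subn1.
have C0 : 'C(n, 2)%:R != 0 :> R by rewrite pnatr_eq0 -lt0n bin_gt0; exact: leq_trans kn.
rewrite /q /m CM !natrM E.
by field.
Qed.

Let q0 : 0 < q.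
Proof. rewrite qE mulr_gt0 //; move: a2pos; lra. Qed.

Let pqE : p = q * (1 + d).
Proof.
rewrite qE /d; have : 1 + a 2 != 0 by apply/eqP; move: a2pos; lra.
by move=> h; field.
Qed.

Let fE w : (w <= k)%N -> (Nc w)%:R = 'C(n, w)%:R * q ^+ 'C(w, 2) * f w.
Proof. by move=> wk; rewrite NcE // {1}pqE exprMn /f; ring. Qed.

Let fgE w : (w <= k)%N -> f w = \sum_(u < k.+1) 'C(w, u)%:R * g u.
Proof.
move=> wk; rewrite /f mulr_sumr.
under [RHS]eq_bigr => u _ do rewrite mulr_sumr.
rewrite exchange_big; apply: eq_bigr => i _ /=.
rewrite mulrA (tiltE d i wk) mulr_suml; apply: eq_bigr => u _; ring.
Qed.

(** From |d| <= 2 |a_2| <= 2 b^2 / C(k, 2) the factor (1 + |d| / b^2)^C(k, 2) is at most e^2. Each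
    of the k + 1 indices i contributes at most b^(D + 1) e^2, and [bk] turns the surplus factor b
    into 1/8. *)
Let tail_bound D :
  \sum_(u < k.+1 | (D < u)%N) 'C(k, u)%:R * `|g u| <= b ^+ D / 8.
Proof.
have b1' : b <= 1 by move: b1; lra.
set E := (1 + `|d| / b ^+ 2) ^+ 'C(k, 2).
have bb : 0 < b ^+ 2 by rewrite exprn_gt0.
have C0 : 0 < 'C(k, 2)%:R :> R by move: C1; lra.
have dE : `|d| <= 2 * `|a 2|.
  have p1 : 0 < 1 + a 2 by move: a2pos; lra.
  have -> : d = - (a 2 / (1 + a 2)) by rewrite /d; field; rewrite gt_eqF.
  rewrite normrN normrM normfV (gtr0_norm p1) mulrC ler_wpM2r //.
  by rewrite -[leRHS]invrK lef_pV2 ?posrE ?invr_gt0.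
have Eb : E <= expR 2.
  have h1 : `|d| / b ^+ 2 <= 2 / 'C(k, 2)%:R.
    rewrite ler_pdivrMr // mulrAC ler_pdivlMr //.
    by move: a2b dE C0; nra.
  have h2 : 1 + `|d| / b ^+ 2 <= expR (2 / 'C(k, 2)%:R).
    by apply: le_trans (expR_ge1Dx _); rewrite lerD2l.
  apply: (@le_trans _ _ (expR (2 / 'C(k, 2)%:R) ^+ 'C(k, 2))).
    by rewrite lerXn2r ?nnegrE ?expR_ge0 // addr_ge0 // divr_ge0 // ltW.
  by rewrite -expRM_natr divfK ?gt_eqF.
have E0 : 0 <= E by rewrite exprn_ge0 // addr_ge0 // divr_ge0 // ltW.
apply: (@le_trans _ _ (\sum_(i < k.+1) `|a i| *
   (\sum_(u < k.+1 | (D < u)%N) 'C(k, u)%:R * `|tilt d k i u|))).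
  under [leRHS]eq_bigr => i _ do rewrite mulr_sumr.
  rewrite exchange_big; apply: ler_sum => u _ /=.
  apply: (@le_trans _ _ ('C(k, u)%:R * \sum_(i < k.+1) `|a i * tilt d k i u|)).
    by rewrite ler_wpM2l // ler_norm_sum.
  rewrite mulr_sumr ler_sum // => i _; rewrite normrM; lra.
apply: (@le_trans _ _ (\sum_(i < k.+1) b ^+ D.+1 * E)); last first.
  rewrite sumr_const card_ord -mulr_natl exprS.
  have bD : 0 <= b ^+ D by rewrite exprn_ge0 // ltW.
  have k0 : 0 <= k.+1%:R :> R by [].
  have : k.+1%:R * b * E <= 8^-1.
    have kb : 0 <= k.+1%:R * b by rewrite mulr_ge0 // ltW.
    by have := ler_wpM2l kb Eb; have := bk; lra.
  by move=> h; have := ler_wpM2l bD h; lra.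
apply: ler_sum => i _.
apply: (@le_trans _ _ (`|a i| * ('C(k, i)%:R * b ^+ (D.+1 - i) * E))).
  by rewrite ler_wpM2l // tilt_tail.
rewrite !mulrA ler_wpM2r // [`|a i| * _]mulrC.
have [i0|i0] := posnP i.
  by rewrite i0 a0 bin0 normr1 !mul1r subn0.
apply: (@le_trans _ _ (b ^+ i * b ^+ (D.+1 - i))).
  by rewrite ler_wpM2r ?exprn_ge0 ?(ltW b0) // ab // i0 -ltnS ltn_ord.
(* The exponent [i + (D.+1 - i)] is at least [D.+1] even where the subtraction truncates. *)
by rewrite -exprD ler_wiXn2l // ?(ltW b0) // -leq_subLR.
Qed.

Let M1 : 0 < M%:R ^+ 'C(k, 2) :> R.
Proof. by rewrite exprn_gt0 // lt0r M0 ler0n. Qed.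

Let termE j w : (w <= j)%N -> (j <= k)%N -> (term n k m M j w (Nc w))%:R =
  M%:R ^+ 'C(k, 2) * ('C(n, k)%:R * q ^+ 'C(k, 2)) * ('C(k, j)%:R * ('C(j, w)%:R * f w)) :> R.
Proof.
move=> wj jk; rewrite /term 4!natrM !natrX fE; last exact: leq_trans jk.
have wk : ('C(w, 2) <= 'C(k, 2))%N by rewrite leq_bin2l //; exact: leq_trans jk.
have mE : m%:R = q * M%:R by rewrite /q divfK.
have E := congr1 (fun x : nat => x%:R : R) (bin_chain wj jk kn).
rewrite !natrM in E.
rewrite mE exprMn -[in RHS](subnK wk) !exprD.
have shuffle (c1 c2 c3 A B C D F : R) :
  c1 * c2 * (A * B) * C * (c3 * D * F) = c1 * c2 * c3 * (A * D) * (B * C) * F by ring.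
have shuffle' (c1 c2 c3 A D B C F : R) :
  B * C * (c1 * (A * D)) * (c2 * (c3 * F)) = c1 * c2 * c3 * (A * D) * (B * C) * F by ring.
by rewrite shuffle shuffle' E.
Qed.

(** The error is the tail of the Newton series beyond [D], which is empty for [D = k]. It is first
    bounded relative to [B]; the inequality [B <= 2 * Nc k] makes it relative to the true count and
    turns 1/8 into 1/4. *)
Lemma interpolation_error D : (D <= k)%N ->
  `|M%:R ^+ 'C(k, 2) * (Nc k)%:R -
    \sum_(j < D.+1) \sum_(w < j.+1) (-1) ^+ (j - w) * (term n k m M j w (Nc w))%:R|
  <= (D < k)%N%:R * (b ^+ D / 4) * (M%:R ^+ 'C(k, 2) * (Nc k)%:R).
Proof.
move=> Dk; set B := 'C(n, k)%:R * q ^+ 'C(k, 2); set MM := M%:R ^+ 'C(k, 2).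
have B0 : 0 < B by rewrite mulr_gt0 ?exprn_gt0 // ltr0n bin_gt0.
have XE : \sum_(j < D.+1) \sum_(w < j.+1) (-1) ^+ (j - w) * (term n k m M j w (Nc w))%:R =
    MM * B * \sum_(j < D.+1) 'C(k, j)%:R * g j.
  rewrite mulr_sumr; apply: eq_bigr => j _.
  have jk : (j <= k)%N by apply: leq_trans Dk; rewrite -ltnS.
  rewrite -(newton fgE jk) !mulr_sumr; apply: eq_bigr => w _.
  rewrite termE ?jk -1?ltnS //; rewrite -/MM -/B; ring.
have NE : (Nc k)%:R = B * \sum_(u < k.+1) 'C(k, u)%:R * g u by rewrite fE // fgE.
have split D' : (D' <= k)%N -> \sum_(u < k.+1) 'C(k, u)%:R * g u =
   \sum_(j < D'.+1) 'C(k, j)%:R * g j + \sum_(u < k.+1 | (D' < u)%N) 'C(k, u)%:R * g u.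
  move=> Dk'; rewrite (bigID (fun u : 'I_k.+1 => (u < D'.+1)%N)) /=.
  rewrite -(big_ord_widen k.+1 (fun u => 'C(k, u)%:R * g u)) //; congr (_ + _).
  by apply: eq_bigl => u; rewrite ltnS -ltnNge.
have tb D' : `|\sum_(u < k.+1 | (D' < u)%N) 'C(k, u)%:R * g u| <= b ^+ D' / 8.
  apply: le_trans (tail_bound D'); apply: le_trans (ler_norm_sum _ _ _) _.
  by apply: ler_sum => u _; rewrite normrM ger0_norm.
have g0 : g 0 = 1.
  have := fgE (leq0n k); rewrite (bigD1 ord0) //= bin0 mul1r big1 ?addr0.
    move=> <-; rewrite /f bin_small // expr0 mul1r (bigD1 ord0) //= bin0 mul1r a0.
    rewrite big1 ?addr0 // => -[[|i] ik] //= _; by rewrite mul0r.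
  by move=> [[|i] ik] //= _; rewrite mul0r.
(* the case D = 0 of the estimate to be proved *)
have N2 : B <= 2 * (Nc k)%:R.
  have := tb 0; rewrite ler_norml expr0 mul1r => /andP[t0 _].
  rewrite NE (split 0) // big_ord1 bin0 g0.
  set t := \sum_(u < k.+1 | _) _ in t0 *; nra.
rewrite XE [in X in `|X|]NE (split D) //.
set t := \sum_(u < k.+1 | _) _; set s := \sum_(j < D.+1) _.
have -> : MM * (B * (s + t)) - MM * B * s = MM * B * t by ring.
have MM0 : 0 < MM := M1.
have [Dk'|kD] := ltnP D k; last first.
  rewrite /t big_pred0 ?mulr0 ?normr0 ?mul0r // => u.
  by apply/negbTE; rewrite -leqNgt; apply: leq_trans kD; rewrite -ltnS.
rewrite mul1r.
rewrite normrM (gtr0_norm (mulr_gt0 MM0 B0)).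
have tD := tb D; rewrite -/t in tD.
have bD : 0 <= b ^+ D by rewrite exprn_ge0 // ltW.
apply: (@le_trans _ _ (MM * B * (b ^+ D / 8))).
  by rewrite ler_wpM2l // mulr_ge0 // ltW.
have : MM * (b ^+ D / 8) * B <= MM * (b ^+ D / 8) * (2 * (Nc k)%:R).
  by rewrite ler_wpM2l // mulr_ge0 ?divr_ge0 // ltW.
lra.
Qed.

End InterpolationError.

(** * Second moments *)

Lemma sum_graph (R : realType) n (F : {set {set 'I_n}} -> R) :
  \sum_(G : graph n) F (val G) = \sum_(E : {set {set 'I_n}} | E \subset pairs n) F E.
Proof.
rewrite [RHS](reindex_omap (val : graph n -> _) insub) /=; last first.
  by move=> E En; rewrite insubT.
by apply: eq_bigl => G; rewrite (valP G) valK eqxx.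
Qed.

(** Independence of the edges: the expectation of a product over the pairs factorizes. *)
Lemma expect_prod (R : realType) (p : R) n (f : {set 'I_n} -> bool -> R) :
  \sum_(G : graph n) gnp p G * \prod_(e in pairs n) f e (e \in val G) =
  \prod_(e in pairs n) (p * f e true + (1 - p) * f e false).
Proof.
pose F (E : {set {set 'I_n}}) := \prod_(e in pairs n)
  ((if e \in E then p else 1 - p) * f e (e \in E)).
transitivity (\sum_(G : graph n) F (val G)).
  by apply: eq_bigr => G _; rewrite /F big_split.
rewrite sum_graph /F.
(* A set [e] that is not a pair contributes 0 + 1, so the expansion over all families retains only
   edge sets of graphs. *)
have -> : \prod_(e in pairs n) (p * f e true + (1 - p) * f e false) =
  \prod_e ((if e \in pairs n then p * f e true else 0) +
           (if e \in pairs n then (1 - p) * f e false else 1)).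
  by rewrite big_mkcond; apply: eq_bigr => e _; case: ifP; rewrite ?add0r.
rewrite bigA_distr [LHS]big_mkcond; apply: eq_bigr => E _.
case: ifPn => [/fintype.subsetP En|/subsetPn[e eE en]].
  rewrite big_mkcond; apply: eq_bigr => e _.
  by case: (boolP (e \in E)) => [/En ->|_] //; case: ifP.
by rewrite (bigD1 e) //= eE (negbTE en) mul0r.
Qed.

Lemma sum_gnp (R : realType) (p : R) n : \sum_(G : graph n) gnp p G = 1.
Proof.
have := @expect_prod R p n (fun _ _ => 1).
rewrite [RHS]big1 => [<-|e _]; last ring.
by apply: eq_bigr => G _; rewrite big1 ?mulr1.
Qed.

Lemma gnp_ge0 (R : realType) (p : R) n (G : graph n) : 0 <= p <= 1 -> 0 <= gnp p G.
Proof. by move=> /andP[p0 p1]; apply: prodr_ge0 => e _; case: ifP => // _; rewrite subr_ge0. Qed.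

(** An edge in exactly one of the two sets contributes a factor of mean 0; an edge in both
    contributes the variance (1 - p) / p. *)
Lemma expect_centered (R : realType) (p : R) n (S S' : {set {set 'I_n}}) : p != 0 ->
  S \subset pairs n -> S' \subset pairs n ->
  \sum_(G : graph n) gnp p G *
    ((\prod_(e in S) centered p G e) * \prod_(e in S') centered p G e) =
  (S == S')%:R * ((1 - p) / p) ^+ #|S|.
Proof.
move=> p0 /fintype.subsetP Sn /fintype.subsetP Sn'.
pose y (b : bool) : R := b%:R / p - 1.
pose f (e : {set 'I_n}) b := (if e \in S then y b else 1) * (if e \in S' then y b else 1).
have prodE (A : {set {set 'I_n}}) G : {subset A <= pairs n} ->
    \prod_(e in A) centered p G e =
    \prod_(e in pairs n) (if e \in A then y (e \in val G) else 1).
  move=> An; rewrite big_mkcond [RHS]big_mkcond; apply: eq_bigr => e _.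
  by case: (boolP (e \in A)) => [/An ->|_] //; case: ifP.
transitivity (\sum_(G : graph n) gnp p G * \prod_(e in pairs n) f e (e \in val G)).
  by apply: eq_bigr => G _; rewrite !prodE // /f big_split.
rewrite (expect_prod p f).
have [E|ne] := eqVneq S S'.
  subst S'; rewrite mul1r -prodr_const big_mkcond [RHS]big_mkcond; apply: eq_bigr => e _.
  case: (boolP (e \in S)) => [eS|neS].
    by rewrite Sn // /f eS /y /=; field.
  by case: ifP => // _; rewrite /f (negbTE neS); ring.
have [e eN eSS] : exists2 e, e \in pairs n & (e \in S) != (e \in S').
  have : ~~ [forall e, (e \in S) == (e \in S')].
    apply: contra ne => /forallP H; apply/eqP/setP => e; exact/eqP.
  rewrite negb_forall => /existsP[e ee]; exists e => //.
  move: ee; case: (boolP (e \in S)) => [/Sn //|_].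
  by case: (boolP (e \in S')) => [/Sn' //|_]; rewrite eqxx.
rewrite mul0r (bigD1 e) //= /f; move: eSS.
by case: (e \in S); case: (e \in S') => // _; rewrite /y /= (_ : _ + _ = 0) ?mul0r //; field.
Qed.

(** By orthogonality only the diagonal survives. For a fixed cover U, enlarge the sum to all edge
    sets within U; by the binomial expansion it becomes (1 + (1 - p) / p)^C(u, 2). *)
Lemma expect_cover_sum2 (R : realType) (p : R) n u : 0 < p -> p <= 1 ->
  \sum_(G : graph n) gnp p G * cover_sum p G u ^+ 2 <= 'C(n, u)%:R * p^-1 ^+ 'C(u, 2).
Proof.
move=> p0 p1.
have s0 : 0 <= (1 - p) / p by rewrite divr_ge0 ?subr_ge0 // ltW.
pose P (S : {set {set 'I_n}}) := (S \subset pairs n) && (#|finset.cover S| == u).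
have -> : \sum_(G : graph n) gnp p G * cover_sum p G u ^+ 2 =
    \sum_(S | P S) ((1 - p) / p) ^+ #|S|.
  transitivity (\sum_(S | P S) \sum_(S' | P S') \sum_(G : graph n) gnp p G *
    ((\prod_(e in S) centered p G e) * \prod_(e in S') centered p G e)).
    under [RHS]eq_bigr => S _ do rewrite exchange_big /=.
    rewrite [RHS]exchange_big /=; apply: eq_bigr => G _.
    rewrite expr2 /cover_sum big_distrlr /= mulr_sumr; apply: eq_bigr => S PS.
    by rewrite mulr_sumr.
  apply: eq_bigr => S PS; have /andP[Sn _] := PS.
  rewrite (bigD1 S) //= expect_centered ?gt_eqF // eqxx mul1r big1 ?addr0 //.
  move=> S' /andP[/andP[Sn' _] ne]; rewrite expect_centered ?gt_eqF //.
  by rewrite eq_sym (negbTE ne) mul0r.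
rewrite (partition_big (fun S => finset.cover S) (fun U => #|U| == u)) /=; last first.
  by move=> S /andP[].
apply: (@le_trans _ _ (\sum_(U : {set 'I_n} | #|U| == u) p^-1 ^+ 'C(u, 2))).
  apply: ler_sum => U /eqP cU.
  have -> : p^-1 ^+ 'C(u, 2) = \sum_(S : {set {set 'I_n}} | S \subset pairs_in U) ((1 - p) / p) ^+ #|S|.
    have := prod_1D (pairs_in U) (fun=> (1 - p) / p).
    rewrite prodr_const card_pairs_in cU => H.
    have pE : 1 + (1 - p) / p = p^-1 by field; rewrite gt_eqF.
    rewrite pE in H; rewrite H; apply: eq_bigr => S _; by rewrite prodr_const.
  rewrite big_mkcond [leRHS]big_mkcond; apply: ler_sum => S _.
  rewrite sub_pairs_in.
  case: ifPn => [/andP[PS /eqP cS]|_].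
    by have /andP[Sn _] := PS; rewrite Sn cS fintype.subxx.
  by case: ifP => // _; exact: exprn_ge0.
rewrite sumr_const -cardsE card_draws card_ord mulr_natl //.
Qed.

(** This is (n / i)^i <= C(n, i), obtained factor by factor from n (i - j) <= i (n - j). *)
Lemma expn_bin n i : (i <= n)%N -> (n ^ i <= i ^ i * 'C(n, i))%N.
Proof.
move=> i_n; rewrite -(leq_pmul2r (fact_gt0 i)) -mulnA bin_ffact -ffactnn.
rewrite !ffact_prod.
have E x : (x ^ i = \prod_(j < i) x)%N by rewrite prod_nat_const card_ord.
rewrite !E -!big_split /=; apply: leq_prod => j _.
rewrite !mulnBr [(i * n)%N]mulnC leq_sub2l // leq_mul2r i_n orbT //.
Qed.

(** Use C(k, i) <= k^i, n^i <= k^i C(n, i) and p^(-C(i, 2)) = s^(i (i - 1)) <= s^(k i). For k near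
    log_{1/p} n, the power s^k is about the square root of n. *)
Lemma second_moment_bound (R : realType) (p s : R) n k i :
  0 < p -> 1 <= s -> s ^+ 2 = p^-1 -> (i <= k)%N -> (k <= n)%N -> (0 < k)%N ->
  'C(k, i)%:R ^+ 2 * p^-1 ^+ 'C(i, 2) / 'C(n, i)%:R <=
  (k%:R ^+ 3 * s ^+ k / n%:R) ^+ i.
Proof.
move=> p0 s1 sp ik kn k0.
have n0 : 0 < n%:R :> R by rewrite ltr0n; lia.
have C0 : 0 < 'C(n, i)%:R :> R by rewrite ltr0n bin_gt0; lia.
have s0 : 0 <= s by lra.
have h1 : 'C(k, i)%:R <= k%:R ^+ i :> R.
  rewrite -natrX ler_nat -(leq_pmul2r (fact_gt0 i)) bin_ffact.
  apply: (@leq_trans (k ^ i)%N); last by rewrite leq_pmulr // fact_gt0.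
  have -> : (k ^ i = \prod_(j < i) k)%N by rewrite prod_nat_const card_ord.
  by rewrite ffact_prod; apply: leq_prod => j _; exact: leq_subr.
have h2 : n%:R ^+ i <= k%:R ^+ i * 'C(n, i)%:R :> R.
  rewrite -!natrX -natrM ler_nat; apply: leq_trans (expn_bin (leq_trans ik kn)) _.
  by rewrite leq_mul2r; apply/orP; right; case: (i) ik => [|i'] ik; rewrite ?expn0 ?leq_exp2r.
have h3 : p^-1 ^+ 'C(i, 2) <= (s ^+ k) ^+ i.
  rewrite -sp -!exprM; apply: ler_weXn2l => //.
  rewrite -(mul_bin_diag i 1) bin1 mulnC leq_mul2r; apply/orP; right; lia.
rewrite expr_div_n ler_pdivrMr // [leRHS]mulrAC ler_pdivlMr ?exprn_gt0 //.
rewrite exprMn -exprM mulnC.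
have a1 : 'C(k, i)%:R ^+ 2 <= (k%:R ^+ i) ^+ 2 :> R by rewrite lerXn2r ?nnegrE.
have -> : (k%:R ^+ (i * 3) : R) = (k%:R ^+ i) ^+ 2 * k%:R ^+ i by rewrite -exprSr exprM.
have -> : (k%:R ^+ i) ^+ 2 * k%:R ^+ i * (s ^+ k) ^+ i * 'C(n, i)%:R =
  (k%:R ^+ i) ^+ 2 * (s ^+ k) ^+ i * (k%:R ^+ i * 'C(n, i)%:R) :> R by ring.
have q0 : 0 <= p^-1 by rewrite invr_ge0 ltW.
by do !apply: ler_pM => //; rewrite ?mulr_ge0 ?exprn_ge0 ?(ltW n0).
Qed.

Definition typical (R : realType) (p b : R) k n (G : graph n) : bool :=
  [forall i : 'I_k.+1, (0 < i)%N ==> ('C(k, i)%:R * `|alpha p G i| <= b ^+ i)].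

(** Markov's inequality for the squares, then a union bound over the [k] indices: index i fails with
    probability at most b^(4 i) / b^(2 i) <= b. *)
Lemma typical_prob (R : realType) (p s b : R) n k :
  0 < p -> p <= 1 -> 1 <= s -> s ^+ 2 = p^-1 -> (0 < k)%N -> (k <= n)%N ->
  0 < b -> b <= 1 -> k%:R ^+ 3 * s ^+ k / n%:R <= b ^+ 4 ->
  1 - k%:R * b <= \sum_(G : graph n) gnp p G * (typical p b k G)%:R.
Proof.
move=> p0 p1 s1 sp k0 kn b0 b1 hb.
have g0 (G : graph n) : 0 <= gnp p G by apply: gnp_ge0; rewrite (ltW p0).
have bad (i : 'I_k.+1) : (0 < i)%N ->
    \sum_(G : graph n) gnp p G * (b ^+ i < 'C(k, i)%:R * `|alpha p G i|)%R%:R <= b.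
  move=> i0; have bi : 0 < b ^+ i by rewrite exprn_gt0.
  have ik : (i <= k)%N by rewrite -ltnS.
  have Cn : 0 < 'C(n, i)%:R :> R by rewrite ltr0n bin_gt0; lia.
  apply: (@le_trans _ _ (\sum_(G : graph n) gnp p G *
      (cover_sum p G i ^+ 2 * (('C(k, i)%:R / 'C(n, i)%:R) ^+ 2 / (b ^+ i) ^+ 2)))).
    apply: ler_sum => G _; rewrite ler_wpM2l //.
    case: ltP => [h|_] /=; last by rewrite mulr_ge0 ?sqr_ge0 // divr_ge0 ?sqr_ge0.
    rewrite mulrA -exprMn ler_pdivlMr ?exprn_gt0 // mul1r.
    have -> : (cover_sum p G i * ('C(k, i)%:R / 'C(n, i)%:R)) ^+ 2 =
        ('C(k, i)%:R * `|alpha p G i|) ^+ 2.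
      by rewrite [RHS]exprMn real_normK ?num_real // -exprMn /alpha; congr (_ ^+ 2); ring.
    by rewrite lerXn2r ?nnegrE ?(ltW bi) ?(ltW h) // mulr_ge0.
  under eq_bigr => G _ do rewrite mulrA.
  rewrite -mulr_suml.
  set c := _ / _; have c0 : 0 <= c by rewrite divr_ge0 ?sqr_ge0.
  apply: le_trans (ler_wpM2r c0 (expect_cover_sum2 n i p0 p1)) _.
  have -> : 'C(n, i)%:R * p^-1 ^+ 'C(i, 2) * c =
    'C(k, i)%:R ^+ 2 * p^-1 ^+ 'C(i, 2) / 'C(n, i)%:R / (b ^+ i) ^+ 2.
    by rewrite /c; field; rewrite !gt_eqF.
  rewrite ler_pdivrMr ?exprn_gt0 //.
  apply: le_trans (second_moment_bound p0 s1 sp ik kn k0) _.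
  apply: (@le_trans _ _ ((b ^+ 4) ^+ i)).
    rewrite lerXn2r ?nnegrE ?exprn_ge0 ?(ltW b0) // divr_ge0 // mulr_ge0 ?exprn_ge0 //; lra.
  by rewrite -!exprM -exprS; apply: ler_wiXn2l => //; [exact: ltW|lia].
have -> : k%:R * b = \sum_(i < k.+1 | (0 < i)%N) b.
  rewrite big_mkcond big_ord_recl /= add0r sumr_const card_ord mulr_natl //.
rewrite lerBlDr -[X in X <= _](sum_gnp p n).
apply: (@le_trans _ _ (\sum_(G : graph n) gnp p G * (typical p b k G)%:R +
   \sum_(i < k.+1 | (0 < i)%N) \sum_(G : graph n) gnp p G *
     (b ^+ i < 'C(k, i)%:R * `|alpha p G i|)%R%:R)); last first.
  by rewrite lerD2l; apply: ler_sum => i; exact: bad.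
rewrite exchange_big /= -big_split /=; apply: ler_sum => G _.
rewrite -mulr_sumr -mulrDr ler_peMr //.
case: (boolP (typical p b k G)) => [_|].
  by rewrite lerDl sumr_ge0.
rewrite negb_forall => /existsP[i]; rewrite negb_imply -ltNge => /andP[i0 h].
by rewrite add0r (bigD1 i) //= h lerDl sumr_ge0.
Qed.

Local Open Scope classical_set_scope.
Local Open Scope ring_scope.

(** * Asymptotics and conclusion *)

Section Asymptotics.
Variables (R : realType) (p : R) (k : nat -> nat).
Hypotheses (hp0 : 0 < p) (hp1 : p < 1)
  (hk : exists2 e : nat -> R, e @ \oo --> (0 : R) &
          \forall n \near \oo, (k n)%:R = (1 + e n) * (ln n%:R / ln p^-1)).

(* n^(-1 / 12) *)
Definition shrink (n : nat) : R := expR (- (ln n%:R / 12)).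

Lemma near_ln (A : R) : \forall n \near \oo, A <= ln (n%:R : R).
Proof.
near=> n; have h : expR A < n%:R by near: n; exact: nbhs_infty_gtr.
by rewrite -[A]expRK ler_ln ?posrE ?expR_gt0 ?ltW // (lt_trans (expR_gt0 A)).
Unshelve. all: by end_near. Qed.

(** With t = ln n, this lets n^(1 / 12) absorb cubes of logarithms. *)
Lemma expR_pow4 (t : R) : 0 <= t -> (t / 48) ^+ 4 <= expR (t / 12).
Proof.
move=> t0; have -> : t / 12 = t / 48 * 4%:R by field.
rewrite expRM_natr lerXn2r ?nnegrE ?expR_ge0 ?divr_ge0 //.
by have := expR_ge1Dx (t / 48); lra.
Qed.

(** Put x = n^(1 / 12), the inverse of [shrink n]. For k <= (7 / 6) log_{1/p} n, p^(-k / 2) <= n^(7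
    / 12) = x^7, while k^3 <= x eventually. Division by n = x^12 leaves at most x^(-4). *)
Lemma near_sizes (del : R) : 0 < del -> del <= 1 -> \forall n \near \oo,
  [/\ (2 <= k n <= n)%N, (k n).+1%:R * shrink n <= del &
      (k n)%:R ^+ 3 * Num.sqrt p^-1 ^+ k n / n%:R <= shrink n ^+ 4].
Proof.
move=> del0 del1; have [e e0 hke] := hk.
have L0 : 0 < ln p^-1 by rewrite ln_gt0 // invf_gt1.
set L := ln p^-1 in L0 hke *.
pose kap := 7 / 6 / L.
have kap0 : 0 < kap by rewrite !divr_gt0.
near=> n.
have en : `|e n| <= 6^-1.
  near: n; move/cvgrPdist_le: e0 => /(_ 6^-1); rewrite invr_gt0 ltr0n => /(_ isT).
  by apply: filterS => n; rewrite sub0r normrN.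
have kE : (k n)%:R = (1 + e n) * (ln n%:R / L) by near: n.
have t1 : 1 <= ln (n%:R : R) by near: n; exact: near_ln.
(* These thresholds serve, in turn, for k >= 2, for k^3 <= x and for k + 1 <= del x. *)
have t2 : 12 / 5 * L <= ln (n%:R : R) by near: n; exact: near_ln.
have t3 : kap ^+ 3 * 48 ^+ 4 <= ln (n%:R : R) by near: n; exact: near_ln.
have t4 : (kap + 1) * 48 ^+ 4 / del <= ln (n%:R : R) by near: n; exact: near_ln.
set t : R := ln n%:R in kE t1 t2 t3 t4.
have n0 : 0 < n%:R :> R.
  rewrite ltr0n lt0n; apply/eqP => n0; move: t1; rewrite /t n0 ln0 //; lra.
have nE : n%:R = expR t by rewrite /t lnK.
have t0 : 0 <= t by lra.
have tL : 0 <= t / L by rewrite divr_ge0 // ltW.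
move: en; rewrite ler_norml => /andP[en1 en2].
have kk : (k n)%:R <= kap * t.
  have -> : kap * t = 7 / 6 * (t / L) by rewrite /kap; field; rewrite gt_eqF.
  by rewrite kE ler_wpM2r //; lra.
have k2 : (2 <= k n)%N.
  rewrite -(ler_nat R) kE; apply: (@le_trans _ _ (5 / 6 * (t / L))).
    rewrite mulrA ler_pdivlMr //; lra.
  by rewrite ler_wpM2r //; lra.
have e4 := expR_pow4 t0.
set x := expR (t / 12) in e4.
have x0 : 0 < x := expR_gt0 _.
have sx : shrink n = x^-1 by rewrite /shrink -/t expRN.
have kx : (k n).+1%:R * shrink n <= del.
  rewrite sx ler_pdivrMr // mulrC -ler_pdivrMr // mulrC.
  apply: le_trans e4; rewrite -natr1.
  apply: (@le_trans _ _ (del^-1 * ((kap + 1) * t))).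
    by rewrite ler_wpM2l ?invr_ge0 ?(ltW del0) //; lra.
  have h4 : (kap + 1) / del <= t / 48 ^+ 4.
    by rewrite ler_pdivlMr ?exprn_gt0 // mulrAC.
  have h5 : t / 48 ^+ 4 * t <= (t / 48) ^+ 4.
    have -> : (t / 48) ^+ 4 = t / 48 ^+ 4 * (t ^+ 3) by field.
    rewrite ler_wpM2l ?divr_ge0 ?exprn_ge0 // ler_eXnr //.
  have := ler_wpM2r t0 h4; lra.
split=> //.
- rewrite k2 /= -(ler_nat R) nE.
  have : (k n).+1%:R <= x.
    by move: kx; rewrite sx ler_pdivrMr // => /le_trans; apply; rewrite ler_piMl // ltW.
  have : x <= expR t by rewrite ler_expR; lra.
  have : (k n)%:R <= (k n).+1%:R :> R by rewrite ler_nat.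
  lra.
have sE : Num.sqrt p^-1 = expR (L / 2).
  have -> : p^-1 = expR (L / 2) ^+ 2.
    rewrite -expRM_natr divfK // /L lnK // posrE invr_gt0 //.
  by rewrite sqrtr_sqr ger0_norm // expR_ge0.
rewrite sE -expRM_natr sx.
have s1 : expR (L / 2 * (k n)%:R) <= x ^+ 7.
  rewrite -expRM_natr ler_expR kE.
  have -> : L / 2 * ((1 + e n) * (t / L)) = (1 + e n) / 2 * t by field; rewrite gt_eqF.
  by have : (1 + e n) / 2 * t <= 7 / 12 * t by [rewrite ler_wpM2r //; lra]; lra.
have nx : n%:R = x ^+ 12 by rewrite nE /x -expRM_natr divfK.
rewrite nx ler_pdivrMr ?exprn_gt0 //.
have -> : x^-1 ^+ 4 * x ^+ 12 = x * x ^+ 7 by field; rewrite gt_eqF.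
apply: ler_pM => //; rewrite ?exprn_ge0 ?expR_ge0 //.
apply: le_trans e4; apply: (@le_trans _ _ ((kap * t) ^+ 3)).
  by rewrite lerXn2r ?nnegrE // mulr_ge0 // ltW.
have -> : (t / 48) ^+ 4 = t ^+ 3 * (t / 48 ^+ 4) by field.
rewrite exprMn mulrC ler_wpM2l ?exprn_ge0 // ler_pdivlMr ?exprn_gt0 //.
Unshelve. all: by end_near. Qed.

End Asymptotics.

(** * Accuracy on typical graphs and convergence of the success probability *)

Lemma prec_gt (R : realType) (eps : R) : 0 < eps -> (prec eps)%:R^-1 < eps.
Proof.
move=> e0; rewrite -[ltRHS]invrK ltf_pV2 ?posrE ?invr_gt0 ?ltr0n //.
by rewrite /prec; apply: truncnS_gt.
Qed.

Lemma natrB_max (R : realType) (a c : nat) : Num.max (a%:R - c%:R) 0 = (a - c)%:R :> R.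
Proof.
have [ca|/ltnW ac] := leqP c a; first by rewrite natrB // max_l // subr_ge0 ler_nat.
by rewrite (eqP ac) max_r // subr_le0 ler_nat.
Qed.

(** Truncating a negative estimate to 0 is harmless because the true count is nonnegative. *)
Lemma accurate_ratio (R : realType) (eps x m y z : R) :
  0 < m -> 0 <= x -> 0 < eps -> z = Num.max y 0 -> `|m * x - y| <= eps * (m * x) ->
  accurate eps x (z / m).
Proof.
move=> m0 x0 e0 ->; rewrite ler_norml => /andP[err1 err2].
have mx : 0 <= m * x by rewrite mulr_ge0 // ltW.
have emx : 0 <= eps * (m * x) by rewrite mulr_ge0 // ltW.
rewrite /accurate ler_pdivlMr // ler_pdivrMr // le_max ge_max.
by apply/andP; split; [apply/orP; left; lra|apply/andP; split; lra].
Qed.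

Lemma typical_accurate (R : realType) (p b eps : R) n k (G : graph n) (s : state) :
  0 < p -> 0 < b -> b ^+ 12 = n%:R^-1 -> (2 <= k <= n)%N ->
  expR 2 * (k.+1%:R * b) <= 8^-1 -> b <= 2^-1 -> 0 < eps ->
  typical p b k G ->
  memory s 0 = sem (input G k (prec eps)) [::] HNum ->
  memory s 1 = sem (input G k (prec eps)) [::] HDen ->
  accurate eps (num_cliques k G)%:R (output R s).
Proof.
move=> p0 b0 b12 /andP[k2 kn] bk bh e0 /forallP tG s0 s1.
set D := level n k (prec eps).
have p0' : p != 0 by rewrite gt_eqF.
have n0 : (0 < n)%N by lia.
have ab i : (0 < i <= k)%N -> 'C(k, i)%:R * `|alpha p G i| <= b ^+ i.
  move=> /andP[i0 ik]; have ik' : (i < k.+1)%N by [].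
  by have /implyP := tG (Ordinal ik'); apply.
have a0 : alpha p G 0 = 1 by rewrite /alpha cover_sum0 bin0 divr1.
have a1 : alpha p G 1 = 0 by rewrite /alpha cover_sum1 mul0r.
have NcE w : (w <= k)%N -> (num_cliques w G)%:R =
    'C(n, w)%:R * p ^+ 'C(w, 2) * \sum_(i < k.+1) 'C(w, i)%:R * alpha p G i.
  move=> wk; rewrite (num_cliques_alpha _ p0') ?(leq_trans wk) //; congr (_ * _).
  rewrite [RHS](big_ord_widen n.+1 (fun i => 'C(w, i)%:R * alpha p G i)) // [RHS]big_mkcond.
  apply: eq_bigr => i _ /=; case: ltnP => // ki.
  by rewrite bin_small ?mul0r //; exact: leq_ltn_trans wk ki.
rewrite mulrA in bk.
have := interpolation_error p0 b0 bh k2 kn a0 a1 ab NcE bk (level_le n k (prec eps)).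
rewrite -/D; set MM := _ ^+ 'C(k, 2); set X := \sum_(j < _) _.
have M0 : 0 < MM.
  by rewrite exprn_gt0 // ltr0n muln_gt0 n0 subn_gt0; lia.
have small : (D < k)%N%:R * (b ^+ D / 4) <= eps.
  have [Dk|_] := ltnP D k; last by rewrite mul0r ltW.
  rewrite mul1r; have bD : b ^+ D <= (prec eps)%:R^-1.
    have q0 : 0 < (prec eps)%:R :> R by rewrite ltr0n.
    (* Compare twelfth powers: b^12 = 1 / n, and below [k] the level satisfies n^D >= q^12. *)
    rewrite -(@ler_pXn2r _ 12) ?nnegrE ?invr_ge0 ?exprn_ge0 ?(ltW b0) //.
    rewrite exprAC b12 !exprVn lef_pV2 ?posrE ?exprn_gt0 ?ltr0n //.
    by rewrite -!natrX ler_nat; exact: level_exact.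
  apply: (@le_trans _ _ (b ^+ D)); last exact: le_trans bD (ltW (prec_gt e0)).
  by rewrite ler_pdivrMr // ler_peMr ?exprn_ge0 ?(ltW b0) // ler1n.
have N0 : 0 <= MM * (num_cliques k G)%:R by rewrite mulr_ge0 // ltW.
move=> err.
have {err} : `|MM * (num_cliques k G)%:R - X| <= eps * (MM * (num_cliques k G)%:R).
  by apply: le_trans err _; rewrite ler_wpM2r.
move=> {}err; rewrite /output s0 s1 sem_num sem_den natrX -/MM -/D.
apply: accurate_ratio err => //.
set P := (\sum_(j < _) _)%N; set N := (\sum_(j < _) _)%N.
have -> : X = P%:R - N%:R.
  rewrite /X /P /N !natr_sum -sumrB; apply: eq_bigr => j _.
  rewrite !natr_sum -sumrB; apply: eq_bigr => w _.
  rewrite -signr_odd; case: (odd _).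
    by rewrite expr1 mul0n mul1n sub0r mulN1r.
  by rewrite expr0 mul1n mul0n subr0 mul1r.
by rewrite -natrB_max.
Qed.

Lemma success_prob_le1 (R : realType) (p : R) P n k T (eps : R) : 0 <= p <= 1 ->
  success_prob p P n k T eps <= 1.
Proof.
move=> p01; rewrite -(sum_gnp p n); apply: ler_sum => G _.
rewrite ler_piMr ?gnp_ge0 // ler_pdivrMr ?exprn_gt0 // mul1r -natrX ler_nat.
by apply: leq_trans (max_card _) _; rewrite card_tuple card_bool.
Qed.

Theorem theorem1 (R : realType) (p : R) (k : nat -> nat)
  (hp0 : 0 < p) (hp1 : p < 1)
  (hk : exists2 e : nat -> R, e @ \oo --> (0 : R) &
          \forall n \near \oo,
            (k n)%:R = (1 + e n) * (ln n%:R / ln p^-1)) :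
  exists P : cmd, is_fpras_cliques p k P.
Proof.
have p01 : 0 <= p <= 1 by rewrite !ltW.
(* The time bound concerns every [n], whereas [k n <= n] holds only eventually; the finitely many
   earlier values are absorbed into [K]. *)
have [K kK] : exists K, forall n, (k n <= K * n.+1)%N.
  have [N _ HN] := near_sizes hp0 hp1 hk ltr01 (lexx 1).
  exists (\sum_(i < N) k i).+1 => n; have [Nn|nN] := leqP N n.
    by have [/andP[_ kn] _ _] := HN n Nn; nia.
  have : (k n <= \sum_(i < N) k i)%N by rewrite (bigD1 (Ordinal nN)) //= leq_addr.
  nia.
have [c Hc] := cliques_programP K.
exists cliques_program, c; split.
  move=> n G eps e0 w /=.
  by have [] := Hc n (k n) (prec eps) G w (kK n) isT (size_tuple w).
move=> eps eps0; apply/cvgrPdist_le => del del0.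
(* The three bounds serve for the failure probability, for b <= 1/2 and for the smallness condition
   of the interpolation. *)
pose dl := Num.min del (Num.min 2^-1 ((8 * expR 2)^-1)).
have dl0 : 0 < dl by rewrite !lt_min del0 !invr_gt0 ltr0n mulr_gt0 ?expR_gt0.
have [dl1 dl2 dl3] : [/\ dl <= del, dl <= 2^-1 & dl <= (8 * expR 2)^-1].
  by rewrite /dl !ge_min !lexx !orbT.
have dl4 : dl <= 1 by lra.
apply: filterS (near_sizes hp0 hp1 hk dl0 dl4) => n [kn kb ks].
set b := shrink R n in kb ks.
have b0 : 0 < b := expR_gt0 _.
have /andP[k2 kn'] := kn.
have k1 : 1 <= (k n).+1%:R :> R by rewrite ler1n.
have bdl : b <= dl by apply: le_trans kb; rewrite ler_peMl // ltW.
have n0 : 0 < n%:R :> R by rewrite ltr0n (leq_trans (ltnW k2)).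
have b12 : b ^+ 12 = n%:R^-1.
  by rewrite /b /shrink -expRM_natr mulNr divfK // expRN lnK.
have eb : expR 2 * ((k n).+1%:R * b) <= 8^-1.
  have E0 := expR_gt0 (2 : R).
  apply: (@le_trans _ _ (expR 2 * (8 * expR 2)^-1)).
    by rewrite ler_wpM2l ?(ltW E0) // (le_trans kb).
  by rewrite invfM mulrCA divff ?mulr1 // gt_eqF.
have sq : Num.sqrt p^-1 ^+ 2 = p^-1 by rewrite sqr_sqrtr // invr_ge0 ltW.
have pV1 : 1 <= p^-1 by rewrite invf_ge1 // ltW.
have s1 : 1 <= Num.sqrt p^-1.
  by rewrite -(ler_pXn2r (isT : (0 < 2)%N)) ?nnegrE ?sqrtr_ge0 // sq expr1n.
have b1 : b <= 1 := le_trans bdl dl4.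
(* This bound does not mention [eps], which makes the convergence uniform in the accuracy. *)
have typ := typical_prob hp0 (ltW hp1) s1 sq (ltnW k2) kn' b0 b1 ks.
have le1 := success_prob_le1 cliques_program n (k n) (budget c n (eps n)) (eps n) p01.
rewrite ger0_norm ?subr_ge0 // lerBlDr.
suff h : \sum_(G : graph n) gnp p G * (typical p b (k n) G)%:R <=
    success_prob p cliques_program n (k n) (budget c n (eps n)) (eps n).
  have := typ; have : (k n)%:R * b <= (k n).+1%:R * b.
    by rewrite ler_wpM2r ?(ltW b0) // ler_nat.
  lra.
(* On a typical graph the deterministic program succeeds for all coin sequences, so their fraction
   is 1; on other graphs nonnegativity suffices. *)
apply: ler_sum => G _; rewrite ler_wpM2l ?gnp_ge0 //.
case: (boolP (typical p b (k n) G)) => [tG|_]; last by rewrite divr_ge0 ?exprn_ge0.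
rewrite (_ : #|_| = (2 ^ budget c n (eps n))%N) ?natrX ?divff ?expf_neq0 //.
rewrite -[X in (X ^ _)%N]card_bool -card_tuple; apply: eq_card => w; rewrite !inE.
have [_ _ m0 m1] := Hc n (k n) (prec (eps n)) G w (kK n) isT (size_tuple w).
exact: (typical_accurate hp0 b0 b12 kn eb (le_trans bdl dl2) (eps0 n) tG m0 m1).
Qed.
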